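(* There is an absolute constant $d$ such that the following holds. Let $N>0$ and let $A,B\ge0$ be integers with $A+B=N$. Let $X$ be chosen uniformly at random among all strings in $\{0,1\}^N$ with exactly $A$ ones and $B$ zeros. Then for every $r\ge1$, $$\Pr_X\left[\,C_{GP}(X)\ge \tfrac12 N+\tfrac13\min(A,B)+d\sqrt{rN}\,\right]\le 2^{-r}\log N.$$
   Context: Logarithms are base $2$. The greedy-pairing algorithm on $X=X_0\cdots X_{N-1}$ maintains a list $\mathcal S=(S_1,\dots,S_\ell)$ of disjoint subsets of $\{0,\dots,N-1\}$ on which $X$ is known to be constant ($X_{S_j}$ denotes that value), initially $(\{0\},\dots,\{N-1\})$. COMBINE$(\mathcal S,i)$ queries $X_a\oplus X_b$ for some $a\in S_i,b\in S_{i+1}$; if $0$, it replaces $S_i,S_{i+1}$ by $S_i\cup S_{i+1}$ at that position; otherwise, if $|S_i|>|S_{i+1}|$ it removes $|S_{i+1}|$ elements from $S_i$ and removes $S_{i+1}$, and if $|S_i|=|S_{i+1}|$ it removes both. Let $s_1$ be the largest $t$ with $2^t\mid |S_1|$ and $s_j=\log|S_j|$ for $j\ge2$. While $\ell>0$ and $|S_1|\le\sum_{j=2}^{\ell}|S_j|$: let $i$ be the smallest $j$ with $s_j=s_{j+1}$; if $\sum_{j=1}^{i}|S_j|>\sum_{j=i+1}^{\ell}|S_j|$ reset $i:=1$; apply COMBINE$(\mathcal S,i)$. Finally output ''tie'' if $\mathcal S$ is empty, else $X_{S_1}$. $C_{GP}(X)$ denotes the number of XOR queries (COMBINE operations) it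 makes on input $X$. *)

(* Defs.v *)
From Stdlib Require Import Reals.
From mathcomp Require Import all_boot.

Set Implicit Arguments.
Unset Strict Implicit.
Unset Printing Implicit Defensive.

(* A state is the list S = (S_1,...,S_l) of disjoint index sets, each given as a
   duplicate-free list of positions of X (X : seq bool, X_k = nth false X k).
   Indices i of the paper are 1-based; S_j = nth [::] S j.-1. *)

Definition gp_combine (X : seq bool) (S : seq (seq nat)) (i : nat) : seq (seq nat) :=
  let Si := nth [::] S i.-1 in
  let Si1 := nth [::] S i in
  let q := nth false X (head 0 Si) (+) nth false X (head 0 Si1) in
  if ~~ q then take i.-1 S ++ (Si ++ Si1) :: drop i.+1 S
  else if size Si1 < size Si then take i.-1 S ++ drop (size Si1) Si :: drop i.+1 S
  else if size Si < size Si1 then take i.-1 S ++ drop (size Si) Si1 :: drop i.+1 S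
  else take i.-1 S ++ drop i.+1 S.

Definition gp_sz (S : seq (seq nat)) (j : nat) : nat := size (nth [::] S j.-1).

(* s_j = s_{j+1}, where s_1 = 2-adic valuation of |S_1| and s_j = log2 |S_j| for
   j >= 2.  For j >= 2, log2 |S_j| = log2 |S_{j+1}| iff |S_j| = |S_{j+1}|;
   for j = 1, v_2(|S_1|) = log2 |S_2| iff |S_2| = 2 ^ v_2(|S_1|). *)
Definition gp_same (S : seq (seq nat)) (j : nat) : bool :=
  if j == 1 then gp_sz S 2 == 2 ^ logn 2 (gp_sz S 1)
  else gp_sz S j == gp_sz S j.+1.

(* smallest j in {1,...,l-1} with s_j = s_{j+1} (equals l if there is none) *)
Definition gp_first_same (S : seq (seq nat)) : nat :=
  (find (gp_same S) (iota 1 (size S).-1)).+1.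

Definition gp_index (S : seq (seq nat)) : nat :=
  let i := gp_first_same S in
  if sumn (map size (drop i S)) < sumn (map size (take i S)) then 1 else i.

Definition gp_cond (S : seq (seq nat)) : bool :=
  (0 < size S) && (size (nth [::] S 0) <= sumn (map size (behead S))).

(* number of COMBINE operations performed (fuel bounds the number of
   iterations; each iteration decreases l, so fuel = N is never exhausted) *)
Fixpoint gp_count (X : seq bool) (fuel : nat) (S : seq (seq nat)) : nat :=
  match fuel with
  | 0 => 0
  | fuel'.+1 =>
      if gp_cond S then (gp_count X fuel' (gp_combine X S (gp_index S))).+1
      else 0
  end.

Definition gp_init (N : nat) : seq (seq nat) := map (fun k => [:: k]) (iota 0 N).

Definition C_GP (X : seq bool) : nat := gp_count X (size X) (gp_init (size X)).

Fixpoint all_strings (n : nat) : seq (seq bool) :=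
  if n is n'.+1 then [seq b :: s | b <- [:: false; true], s <- all_strings n']
  else [:: [::]].

Definition prob_uniform (N A : nat) (E : seq bool -> bool) : R :=
  let supp := [seq X <- all_strings N | count (fun b : bool => b) X == A] in
  Rdiv (INR (size [seq X <- supp | E X])) (INR (size supp)).

Definition Rleb (x y : R) : bool := if Rle_dec x y then true else false.

Definition log2 (x : R) : R := Rdiv (ln x) (ln 2).

(* Main.v *)
Require Import Defs.
From Stdlib Require Import Reals Lra ZArith.
From mathcomp Require Import all_boot.
From mathcomp Require Import zify.

Set Implicit Arguments.
Unset Strict Implicit.
Unset Printing Implicit Defensive.

(* Let W be the walk of X counting majority minus minority letters, so that
   W(m) = theta m + O(sqrt(rN)) for all m at once, theta = |A-B|/N, outside an
   event of small probability.  Every block of the algorithm comes from a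
   contiguous segment of X over which |W| changes by the size of the block, and
   the sizes (apart from the first) are distinct powers of 2; hence the sizes of
   the blocks processed so far add up to theta n + O(sqrt(rN)) when n letters
   have been read.  So until n1 = N/(1+theta) - O(sqrt(rN)) letters have been
   read there is no reset and the algorithm is a binary counter, and it never
   reads more than n2 = N/(1+theta) + O(sqrt(rN)) letters.  Each query removes
   one block, or two if it cancels a pair, so the number of queries is at most
   n2 minus the number of pairs cancelled among the first n1 letters.

   The latter is counted level by level: pair up the letters, cancel the mixed
   pairs, keep one letter per remaining pair and repeat.  A uniform string with
   prescribed counts stays uniform at the next level given the counts, and the
   potential m/3 - |d|/2 + d^2/(6m), with m the length and d the lead, is a lower
   bound for the expected number of cancellations at the precision needed:
   n2 - potential(n1, theta n1) = N/2 + min(A,B)/3 + O(sqrt(rN)). *)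

(** * The algorithm on sizes and values of blocks *)

Definition block := (nat * bool)%type.

Definition fuse (x y : block) : seq block :=
  if x.2 == y.2 then [:: (x.1 + y.1, x.2)]
  else if y.1 < x.1 then [:: (x.1 - y.1, x.2)]
  else if x.1 < y.1 then [:: (y.1 - x.1, y.2)]
  else [::].

Definition same (s : seq nat) (j : nat) : bool :=
  if j == 1 then nth 0 s 1 == 2 ^ logn 2 (nth 0 s 0)
  else nth 0 s j.-1 == nth 0 s j.

Definition first_same (s : seq nat) : nat :=
  (find (same s) (iota 1 (size s).-1)).+1.

Definition next_index (s : seq nat) : nat :=
  if sumn (drop (first_same s) s) < sumn (take (first_same s) s) then 1
  else first_same s.

Definition active (s : seq nat) : bool :=
  (0 < size s) && (nth 0 s 0 <= sumn (behead s)).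

Definition sizes (S : seq block) : seq nat := map fst S.

Definition combine (S : seq block) (i : nat) : seq block :=
  take i.-1 S ++ fuse (nth (0, false) S i.-1) (nth (0, false) S i)
    ++ drop i.+1 S.

Fixpoint steps (fuel : nat) (S : seq block) : nat :=
  if fuel is fuel'.+1 then
    if active (sizes S) then (steps fuel' (combine S (next_index (sizes S)))).+1
    else 0
  else 0.

Definition constant_on (X : seq bool) (b : seq nat) : bool :=
  (b != [::]) && all (fun k => nth false X k == nth false X (head 0 b)) b.

Definition block_of (X : seq bool) (b : seq nat) : block :=
  (size b, nth false X (head 0 b)).

Lemma sizes_block_of X S : sizes (map (block_of X) S) = map size S.
Proof. by rewrite /sizes -map_comp. Qed.

Lemma size_nth_nil (S : seq (seq nat)) j :
  size (nth [::] S j) = nth 0 (map size S) j.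
Proof.
case: (ltnP j (size S)) => h; first by rewrite (nth_map [::]).
by rewrite !nth_default ?size_map.
Qed.

Lemma gp_same_sizes S j : gp_same S j = same (map size S) j.
Proof. by rewrite /gp_same /same /gp_sz !size_nth_nil. Qed.

Lemma gp_index_sizes S : gp_index S = next_index (map size S).
Proof.
rewrite /gp_index /next_index /gp_first_same /first_same size_map.
by rewrite (eq_find (gp_same_sizes S)) !map_take !map_drop.
Qed.

Lemma gp_cond_sizes S : gp_cond S = active (map size S).
Proof.
rewrite /gp_cond /active size_map size_nth_nil; congr (_ && (_ <= _)).
by case: S.
Qed.

Lemma first_same_le s : first_same s <= (size s).-1.+1.
Proof. by rewrite /first_same ltnS -{2}(size_iota 1 (size s).-1) find_size. Qed.

(** When no two neighbours match, [first_same] is the length of the list; nothing remains to its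
    right, so the reset gives index 1. Positive sizes force an active list to have a second
    block. *)
Lemma index_bounds s : all (leq 1) s -> active s -> 0 < next_index s < size s.
Proof.
move=> pos /andP[s0 act].
have s2 : 1 < size s.
  case: s pos act s0 => [|x [|y s]] //= /andP[]; lia.
rewrite /next_index; have := first_same_le s.
set i := first_same s; have i0 : 0 < i by [].
case: ifP => [_ _|]; first by rewrite s2.
move=> /negbT; rewrite -leqNgt => h1 h2; rewrite i0 /=.
rewrite ltn_neqAle; apply/andP; split; last by lia.
apply/eqP => e; move: h1; rewrite e drop_size take_size /=.
by case: s pos s0 {act s2 i i0 e h2} => //= x s /andP[]; lia.
Qed.

Lemma constant_on_cat X b c :
  constant_on X b -> constant_on X c ->
  nth false X (head 0 b) = nth false X (head 0 c) ->
  constant_on X (b ++ c).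
Proof.
case: b => // x b; case: c => // y c; rewrite /constant_on /=.
move=> /andP[h1 h2] /andP[h3 h4] e.
rewrite all_cat /= h1 h2 /= -?e eqxx /=.
by apply/allP => k kc; rewrite e; move/allP: h4 => /(_ _ kc).
Qed.

Lemma constant_on_drop X b n : constant_on X b -> n < size b ->
  constant_on X (drop n b) /\
  nth false X (head 0 (drop n b)) = nth false X (head 0 b).
Proof.
move=> /andP[_ /allP h] nb.
have hd : nth false X (head 0 (drop n b)) = nth false X (head 0 b).
  apply/eqP/h; rewrite -nth0 nth_drop addn0; exact: mem_nth.
split=> //; apply/andP; split; first by rewrite -size_eq0 size_drop subn_eq0 -ltnNge.
by apply/allP => k /mem_drop kb; rewrite hd; apply: h.
Qed.

Lemma gp_combine_blocks X S i :
  all (constant_on X) S -> 0 < i < size S ->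
  map (block_of X) (gp_combine X S i) = combine (map (block_of X) S) i
  /\ all (constant_on X) (gp_combine X S i).
Proof.
move=> cS /andP[i0 iS].
set b := nth [::] S i.-1; set c := nth [::] S i.
have cb : constant_on X b by apply: (all_nthP _ cS); lia.
have cc : constant_on X c by apply: (all_nthP _ cS).
have ct : all (constant_on X) (take i.-1 S).
  by apply/allP => z /mem_take; apply/allP.
have cd : all (constant_on X) (drop i.+1 S).
  by apply/allP => z /mem_drop; apply/allP.
rewrite /combine !(nth_map [::]) //; last by lia.
rewrite /gp_combine -/b -/c -!map_take -!map_drop /fuse /=.
case: eqP => [e|/eqP e].
  rewrite e addbb /= map_cat all_cat /= ct cd andbT; split.
    rewrite /block_of size_cat -e; congr (_ ++ (_, _) :: _).
    by case: (b) cb.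
  exact: constant_on_cat.
have -> : nth false X (head 0 b) (+) nth false X (head 0 c) = true.
  by move: e; do 2 case: (nth _ _ _).
move=> /=.
case: ifP => [l|_].
  have [h1 h2] := constant_on_drop cb l.
  by rewrite map_cat /= all_cat /= ct cd h1 /block_of size_drop h2.
case: ifP => [l|_].
  have [h1 h2] := constant_on_drop cc l.
  by rewrite map_cat /= all_cat /= ct cd h1 /block_of size_drop h2.
by rewrite map_cat all_cat ct cd.
Qed.

Lemma gp_count_steps X fuel S : all (constant_on X) S ->
  gp_count X fuel S = steps fuel (map (block_of X) S).
Proof.
elim: fuel S => //= fuel IH S cS.
rewrite gp_cond_sizes gp_index_sizes sizes_block_of.
case: ifP => // act.
have pos : all (leq 1) (map size S).
  apply/allP => _ /mapP[b bS ->].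
  by move/allP: cS => /(_ _ bS) /andP[]; rewrite -size_eq0 lt0n.
have := index_bounds pos act; rewrite size_map => /(gp_combine_blocks cS)[e c].
by rewrite IH // e.
Qed.

Definition singles (X : seq bool) (m : nat) : seq block :=
  [seq (1, x) | x <- drop m X].

Lemma C_GP_steps X : C_GP X = steps (size X) (singles X 0).
Proof.
rewrite /C_GP gp_count_steps; last first.
  by apply/allP => _ /mapP[k _ ->]; rewrite /constant_on /= eqxx.
congr steps; rewrite /singles drop0 /gp_init -map_comp.
have := mkseq_nth false X; rewrite /mkseq => {3}<-; rewrite -map_comp.
by apply: eq_map => k.
Qed.

(** * Chains of powers of 2 *)

Definition pow2 (x : nat) : bool := x == 2 ^ logn 2 x.

(** The first size is replaced by the largest power of 2 dividing it, so that the test s_j = s_(j+1)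
    becomes equality of neighbouring keys. *)
Definition keys (s : seq nat) : seq nat :=
  if s is x :: s' then 2 ^ logn 2 x :: s' else [::].

(* The sizes of the blocks of a binary counter, except that resets may have
   turned the first one into an arbitrary number. *)
Definition chain (s : seq nat) : bool :=
  [&& all (leq 1) s, all pow2 (behead s) & sorted gtn (keys s)].

Lemma size_keys s : size (keys s) = size s.
Proof. by case: s. Qed.

Lemma keys_cat s t : s != [::] -> keys (s ++ t) = keys s ++ t.
Proof. by case: s. Qed.

Lemma keys_rcons s a : s != [::] -> keys (rcons s a) = rcons (keys s) a.
Proof. by case: s. Qed.

Lemma sizes_rcons Q x : sizes (rcons Q x) = rcons (sizes Q) x.1.
Proof. exact: map_rcons. Qed.

Lemma sizes_cat P Q : sizes (P ++ Q) = sizes P ++ sizes Q.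
Proof. exact: map_cat. Qed.

Lemma sorted_gtn_rcons s a : s != [::] ->
  sorted gtn (rcons s a) = sorted gtn s && (a < last 0 s).
Proof. by case: s => //= x s _; rewrite rcons_path. Qed.

Lemma chain_rcons s a : s != [::] ->
  chain (rcons s a) = [&& chain s, 0 < a, pow2 a & a < last 0 (keys s)].
Proof.
move=> s0; rewrite /chain keys_rcons // sorted_gtn_rcons; last first.
  by rewrite -size_eq0 size_keys size_eq0.
case: s s0 => // x s _; rewrite /= !all_rcons /=.
by case: (0 < x); case: (0 < a); case: (pow2 a); case: (all _ s);
  case: (all _ s); rewrite ?andbF.
Qed.

Lemma chain1 a : chain [:: a] = (0 < a).
Proof. by rewrite /chain /= !andbT. Qed.

Lemma chain_pos s : chain s -> all (leq 1) s.
Proof. by case/and3P. Qed.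

Lemma find_iota (p : pred nat) m n k : k < n -> p (m + k) ->
  (forall j, j < k -> ~~ p (m + j)) -> find p (iota m n) = k.
Proof.
move=> kn pk np; rewrite -(subnKC (ltnW kn)) iotaD find_cat size_iota.
have -> : has p (iota m k) = false.
  apply/hasPn => j; rewrite mem_iota => /andP[mj jk].
  by rewrite -(subnKC mj); apply: np; lia.
have [r ->] : exists r, n - k = r.+1 by exists (n - k).-1; lia.
by rewrite /= pk addn0.
Qed.

Lemma same_keys s j : 0 < j < size s ->
  same s j = (nth 0 (keys s) j.-1 == nth 0 (keys s) j).
Proof.
case: s => [|x [|y s]] //=; try lia.
by case: j => [|[|j]] //= _; rewrite /same /= eq_sym.
Qed.

Lemma sorted_keys_not_same s j : sorted gtn (keys s) -> 0 < j < size s ->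
  nth 0 (keys s) j < nth 0 (keys s) j.-1.
Proof.
move=> /(sortedP 0) so /andP[j0 js]; have := so j.-1.
by rewrite prednK // size_keys => /(_ js).
Qed.

(** Strictly decreasing keys contain no match, so [first_same] is the full length and the empty sum
    on the right triggers the reset. *)
Lemma index_chain s : all (leq 1) s -> s != [::] -> sorted gtn (keys s) ->
  next_index s = 1.
Proof.
move=> pos s0 so.
have e : first_same s = size s.
  rewrite /first_same hasNfind ?size_iota.
    by rewrite prednK // lt0n size_eq0.
  apply/hasPn => j; rewrite mem_iota => jb.
  have jb' : 0 < j < size s by lia.
  by rewrite same_keys // gtn_eqF // sorted_keys_not_same.
rewrite /next_index e drop_size take_size /=.
by case: s pos s0 {so e} => //= x s /andP[]; case: ifP => //; lia.
Qed.

Lemma index_weak P x y R : chain (rcons P x) -> last 0 (keys (rcons P x)) = y ->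
  next_index (rcons P x ++ y :: R) =
  if y + sumn R < sumn (rcons P x) then 1 else (size P).+1.
Proof.
move=> /and3P[_ _ so] la; set s := _ ++ _.
have ks : keys s = keys (rcons P x) ++ y :: R.
  by rewrite /s keys_cat // -size_eq0 size_rcons.
have szs : size s = (size P).+2 + size R.
  by rewrite /s size_cat size_rcons /= -addSnnS.
have e : first_same s = (size P).+1.
  congr _.+1; apply: find_iota; first by lia.
    rewrite same_keys; last by lia.
    rewrite ks add1n /= !nth_cat size_keys size_rcons ltnn subnn ltnSn /=.
    by rewrite -la -nth_last size_keys size_rcons.
  move=> j jP; rewrite same_keys; last by lia.
  rewrite ks add1n /= !nth_cat size_keys size_rcons !ltnS jP (ltnW jP).
  rewrite gtn_eqF // (@sorted_keys_not_same (rcons P x) j.+1) //.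
  by rewrite size_rcons; lia.
rewrite /next_index e /s -(size_rcons P x).
by rewrite drop_size_cat // take_size_cat.
Qed.

Lemma combine_cat P x y R :
  combine (P ++ x :: y :: R) (size P).+1 = P ++ fuse x y ++ R.
Proof.
rewrite /combine /= take_size_cat // !nth_cat ltnn subnn ltnNge leqnSn /=.
rewrite subSnn /=; congr (_ ++ (_ ++ _)).
rewrite drop_cat ltnNge leqW ?leqW //=.
by rewrite -addn2 addKn /= drop0.
Qed.

Lemma combine_front x y R : combine (x :: y :: R) 1 = fuse x y ++ R.
Proof. exact: (@combine_cat [::]). Qed.

Lemma size_fuse x y : size (fuse x y) <= 1.
Proof. by rewrite /fuse; do 3 case: ifP => // _. Qed.

Lemma size_combine S i : 0 < i < size S -> size (combine S i) < size S.
Proof.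
move=> h; rewrite /combine !size_cat size_drop size_takel; last by lia.
set a := nth _ _ i.-1; set b := nth _ _ i.
have := size_fuse a b; lia.
Qed.

(** With [y] = 2^b and b below the valuation of [x], the number [x] is an even multiple of 2^b,
    hence [x + y] and [x - y] are odd multiples of it. *)
Lemma logn_pow2_add x y : 0 < x -> pow2 y -> y < 2 ^ logn 2 x ->
  logn 2 (x + y) = logn 2 y /\ logn 2 (x - y) = logn 2 y.
Proof.
move=> x0 /eqP; set b := logn 2 y => -> h.
set a := logn 2 x.
have ba : b < a by move: h; rewrite ltn_exp2l.
have [c ex] : exists c, x = 2 ^ a * c.
  by have /dvdnP[c ->] := pfactor_dvdnn 2 x; exists c; rewrite mulnC.
have c0 : 0 < c by case: c ex x0 => //; rewrite muln0 => ->.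
have e2 : x = 2 ^ b * (2 * (2 ^ (a - b.+1) * c)).
  by rewrite ex !mulnA -expnSr -expnD subnKC.
set q := 2 ^ (a - b.+1) * c in e2.
have q0 : 0 < q by rewrite muln_gt0 expn_gt0.
have odd0 z : odd z -> logn 2 (2 ^ b * z) = b.
  move=> oz; rewrite lognM ?expn_gt0 //; last by case: z oz.
  by rewrite pfactorK // logn_coprime ?addn0 // coprime2n.
split; rewrite e2.
  have -> : 2 ^ b * (2 * q) + 2 ^ b = 2 ^ b * (2 * q).+1 by rewrite mulnS addnC.
  by apply: odd0; rewrite /= oddM.
have -> : 2 ^ b * (2 * q) - 2 ^ b = 2 ^ b * (2 * q).-1.
  by rewrite -[X in _ - X]muln1 -mulnBr subn1.
apply: odd0; have -> : (2 * q).-1 = (2 * q.-1).+1 by lia.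
by rewrite /= oddM.
Qed.

Lemma pow2_logn_le x : 0 < x -> 2 ^ logn 2 x <= x.
Proof. by move=> x0; apply: dvdn_leq => //; apply: pfactor_dvdnn. Qed.

(** This keeps a chain intact under a reset. Either outcome inherits the valuation of [y], so the
    first key just disappears; a cancellation leaves a remainder because [y] is smaller than the key
    of [x]. *)
Lemma fuse_front x y R : chain (sizes (x :: y :: R)) ->
  exists z, [/\ fuse x y = [:: z], chain (sizes (z :: R))
   & keys (sizes (z :: R)) = behead (keys (sizes (x :: y :: R)))].
Proof.
case: x y => [x u] [y v]; rewrite /chain /= => /and3P[].
move=> /and3P[x0 y0 pR] /andP[py ppR] /andP[xy so].
have [l1 l2] := logn_pow2_add x0 py xy.
have yx : y < x := leq_trans xy (pow2_logn_le x0).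
rewrite /fuse /=; case: eqP => _.
  exists (x + y, u); rewrite /= l1 -(eqP py); split=> //.
  by rewrite pR ppR so addn_gt0 x0.
rewrite yx; exists (x - y, u); rewrite /= l2 -(eqP py); split=> //.
by rewrite pR ppR so subn_gt0 yx.
Qed.

(** The second case is a pending carry: the last block matches the key of its predecessor. *)
Definition almost_chain (Q : seq block) : Prop :=
  chain (sizes Q) \/
  exists Q0 y, [/\ Q = rcons Q0 y, Q0 != [::], chain (sizes Q0)
                 & last 0 (keys (sizes Q0)) = y.1].

Lemma last_keys_rcons s a : s != [::] -> last 0 (keys (rcons s a)) = a.
Proof. by move=> s0; rewrite keys_rcons // last_rcons. Qed.

Lemma almost_chain_fuse1 x y : 0 < x.1 -> almost_chain (fuse x y).
Proof.
case: x y => [x u] [y v] /= x0; left; rewrite /fuse /=.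
case: eqP => _; first by rewrite /= chain1 addn_gt0 x0.
case: ltnP => l1; first by rewrite /= chain1 subn_gt0.
case: ltnP => l2 //; by rewrite /= chain1 subn_gt0.
Qed.

(** A carry either cancels, leaving a chain, or doubles the last block. Keys being powers of 2, the
    doubled block is at most the preceding key, and equality is a new pending carry. *)
Lemma almost_chain_fuse P x y : chain (sizes (rcons P x)) ->
  last 0 (keys (sizes (rcons P x))) = y.1 -> almost_chain (P ++ fuse x y).
Proof.
case/lastP: P => [|P p].
  rewrite /= chain1 => x0 _; exact: almost_chain_fuse1.
set P' := rcons P p; have P0 : P' != [::] by rewrite -size_eq0 size_rcons.
have sP0 : sizes P' != [::] by rewrite -size_eq0 size_map size_eq0.
rewrite sizes_rcons chain_rcons // last_keys_rcons // => /and4P[cP x0 px xl] e.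
case: x y => [x u] [y v] /= in x0 px xl e *; rewrite -{}e /fuse /=.
case: eqP => _; last by rewrite ltnn cats0; left.
rewrite cats1; set k := last 0 _ in xl.
have pk : pow2 k.
  rewrite /k /P' sizes_rcons.
  have [->|sP] := eqVneq (sizes P) [::]; first by rewrite /pow2 /= pfactorK.
  rewrite last_keys_rcons //.
  by move: cP; rewrite sizes_rcons chain_rcons // => /and4P[].
have xxe : x + x = 2 ^ (logn 2 x).+1 by rewrite {1 2}(eqP px) addnn expnS mul2n.
have : x + x <= k.
  by move: xl; rewrite xxe (eqP pk) {1}(eqP px) ltn_exp2l // leq_exp2l.
rewrite leq_eqVlt => /orP[/eqP xk|xk]; last first.
  left; rewrite sizes_rcons chain_rcons // cP xk addn_gt0 x0 /= andbT.
  by rewrite /= xxe /pow2 pfactorK.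
right; exists P', (x + x, u); split=> //; exact: esym.
Qed.

(** * Blocks as segments of the walk *)

Arguments Z.mul : simpl never.
Arguments Z.add : simpl never.
Arguments Z.of_nat : simpl never.

Definition walk (v : bool) (X : seq bool) (m : nat) : Z :=
  (2 * Z.of_nat (count_mem v (take m X)) - Z.of_nat (size (take m X)))%Z.

Definition weight (v : bool) (b : block) : Z :=
  if b.2 == v then Z.of_nat b.1 else (- Z.of_nat b.1)%Z.

(* The blocks of [Q] come from consecutive segments of the positions [c..m),
   and everything else in these segments has cancelled out. *)
Fixpoint segmented v X (c : nat) (Q : seq block) (m : nat) : Prop :=
  if Q is b :: Q' then
    exists c', [/\ c <= c', walk v X c' = (walk v X c + weight v b)%Z
                 & segmented v X c' Q' m]
  else c <= m /\ walk v X m = walk v X c.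

Lemma walkS v X m : m < size X ->
  walk v X m.+1 = (walk v X m + weight v (1%N, nth false X m))%Z.
Proof.
move=> mX; rewrite /walk (take_nth false mX) -cats1 count_cat size_cat /=.
by rewrite /weight /=; case: eqP => _; lia.
Qed.

Lemma segmented_le v X c Q m : segmented v X c Q m -> c <= m.
Proof.
elim: Q c => [c []|b Q IH c] //= [c' [cc' _ /IH]].
exact: leq_trans.
Qed.

Lemma segmented_shift v X c c' Q m : c <= c' -> walk v X c' = walk v X c ->
  segmented v X c' Q m -> segmented v X c Q m.
Proof.
case: Q => [|b Q] /= cc' e; first by case=> h1 h2; split; [lia|congruence].
case=> d [h1 h2 h3]; exists d; split=> //; first lia.
by rewrite -e.
Qed.

Lemma weight_fuse v x y :
  (forall z, fuse x y = [:: z] -> weight v z = (weight v x + weight v y)%Z)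
  /\ (fuse x y = [::] -> (weight v x + weight v y = 0)%Z).
Proof.
case: x y => [x u] [y w]; rewrite /fuse /weight /=; split.
  move=> z; case: (ltngtP y x) => h;
  by case: u; case: w; case: v => //= -[<-] /=; lia.
case: (ltngtP y x) => h; by case: u; case: w; case: v => //= _; lia.
Qed.

(** Either answer preserves the total signed weight, so the two segments become one. If nothing
    survives, the joint segment has increment 0 and is absorbed by what follows. *)
Lemma segmented_fuse v X c P x y R m :
  segmented v X c (P ++ x :: y :: R) m ->
  segmented v X c (P ++ fuse x y ++ R) m.
Proof.
elim: P c => [|b P IH] c /=; last first.
  by case=> c' [h1 h2 /IH h3]; exists c'.
case=> c1 [h1 h2 [c2 [h3 h4 h5]]].
have [w1 w0] := weight_fuse v x y.
have := size_fuse x y; case: fuse w1 w0 => [|z [|//]] w1 w0 _ /=.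
  apply: segmented_shift h5; first lia.
  by have := w0 erefl; lia.
by exists c2; split=> //; [lia|have := w1 z erefl; lia].
Qed.

Lemma segmented_rcons v X c Q m : segmented v X c Q m -> m < size X ->
  segmented v X c (rcons Q (1, nth false X m)) m.+1.
Proof.
move=> h mX; elim: Q c h => [|b Q IH] c /=.
  by case=> cm e; exists m.+1; split=> //; [lia|rewrite walkS // e].
by case=> c' [h1 h2 /IH h3]; exists c'.
Qed.

Lemma segmented_sum v X c Q m : segmented v X c Q m ->
  (walk v X m <= walk v X c + Z.of_nat (sumn (sizes Q)))%Z.
Proof.
elim: Q c => [|b Q IH] c /=; first by case=> _ ->; lia.
by case=> c' [_ h /IH]; rewrite /weight in h; case: eqP h => _; lia.
Qed.

Lemma walk0 v X : walk v X 0 = 0%Z.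
Proof. by rewrite /walk take0. Qed.

(** * States reached by the algorithm, resets included *)

Lemma singles_cons X m : m < size X ->
  singles X m = (1, nth false X m) :: singles X m.+1.
Proof. by move=> mX; rewrite /singles (drop_nth false). Qed.

Lemma singles_nil X m : size X <= m -> singles X m = [::].
Proof. by move=> h; rewrite /singles drop_oversize. Qed.

Lemma sumn_singles X m : sumn (sizes (singles X m)) = size X - m.
Proof.
rewrite /sizes /singles -map_comp -size_drop.
by elim: drop => //= x s ->.
Qed.

Lemma size_singles X m : size (singles X m) = size X - m.
Proof. by rewrite size_map size_drop. Qed.

Lemma singles_pos X m : all (leq 1) (sizes (singles X m)).
Proof. by rewrite /sizes /singles -map_comp; elim: drop. Qed.

Definition reachable v X n2 (S : seq block) : Prop :=
  exists Q m, [/\ S = Q ++ singles X m, segmented v X 0 Q m, m <= n2,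
    m <= size X & almost_chain Q].

Lemma almost_chain_pos Q : almost_chain Q -> all (leq 1) (sizes Q).
Proof.
case=> [/chain_pos //|[Q0 [y [-> s0 c e]]]].
rewrite sizes_rcons all_rcons (chain_pos c) andbT -e.
case: Q0 s0 c {e} => // x Q0 _; case/lastP: Q0 => [|Q0 z] /= c.
  by rewrite expn_gt0.
by rewrite sizes_rcons last_rcons; move: (chain_pos c); 
  rewrite /= sizes_rcons all_rcons => /and3P[].
Qed.

(** Fusing at the front keeps all later keys, so a pending carry at the end survives. With only two
    blocks, a pending carry is itself at the front and may cancel completely; the side condition
    excludes this. *)
Lemma almost_chain_front x y R : almost_chain (x :: y :: R) ->
  0 < size R \/ chain (sizes [:: x; y]) ->
  exists2 z, fuse x y = [:: z] & almost_chain (z :: R).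
Proof.
case=> [/fuse_front[z [e c _]] _|]; first by exists z => //; left.
case=> Q0 [w [e s0 c la]] h; case: Q0 e s0 c la h => // x' [|y' Q0] /=.
  case=> -> -> -> _ c la [//|c2]; exfalso.
  move: c2; rewrite /chain /= => /and3P[_ _ /andP[]].
  by rewrite la ltnn.
case=> -> -> -> _ c la _; have [z [e cz ez]] := fuse_front c.
exists z => //; right; exists (z :: Q0), w; split=> //.
by rewrite ez /= -la; case: (Q0).
Qed.

Lemma segmented_sum0 v X Q m : segmented v X 0 Q m ->
  (walk v X m <= Z.of_nat (sumn (sizes Q)))%Z.
Proof. by move/segmented_sum; rewrite walk0. Qed.

(** New letters are read only while the processed blocks weigh at most as much as the unread
    letters. Their weight dominates the walk, so the first hypothesis applies; its 2 is the largest
    number of letters that one COMBINE can consume. *)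
Lemma reachable_combine v X n2 S :
  (forall m, m <= size X -> (walk v X m <= Z.of_nat (size X - m))%Z ->
     m + 2 <= n2) ->
  reachable v X n2 S -> active (sizes S) ->
  reachable v X n2 (combine S (next_index (sizes S))) /\
  size (combine S (next_index (sizes S))) < size S.
Proof.
move=> F2 [Q [m [eS gQ mn mX aQ]]] act.
have posS : all (leq 1) (sizes S).
  by rewrite eS sizes_cat all_cat almost_chain_pos ?singles_pos.
have := index_bounds posS act; rewrite size_map => ib.
split; last exact: size_combine.
have read : (walk v X m <= Z.of_nat (size X - m))%Z -> m + 2 <= n2 by exact: F2.
have gsum := segmented_sum0 gQ.
have [i1|iN1] := eqVneq (next_index (sizes S)) 1.
  rewrite i1 {ib i1}; case: Q eS gQ aQ gsum => [|x [|y Q]] eS gQ aQ gsum.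
  - rewrite {}eS /= in act *.
    have hm : m + 2 <= n2 by apply: read; move: gsum => /=; lia.
    case: (ltnP m (size X)) act => [mX'|mX']; last by rewrite singles_nil.
    rewrite singles_cons //.
    case: (ltnP m.+1 (size X)) => [mX2|mX2]; last by rewrite singles_nil.
    rewrite singles_cons // combine_front => _.
    exists (fuse (1, nth false X m) (1, nth false X m.+1)), m.+2.
    split=> //; try lia; last exact: almost_chain_fuse1.
    rewrite -[fuse _ _]cats0; apply: (@segmented_fuse _ _ _ [::]).
    by have := segmented_rcons (segmented_rcons gQ mX') mX2.
  - rewrite {}eS /= in act posS *.
    move: act => /andP[_] /=; rewrite sumn_singles => act.
    have x0 : 0 < x.1 by case/andP: posS.
    have mX' : m < size X by lia.
    rewrite singles_cons // combine_front.
    exists (fuse x (1, nth false X m)), m.+1; split=> //.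
    + rewrite -[fuse _ _]cats0; apply: (@segmented_fuse _ _ _ [::]).
      exact: (segmented_rcons gQ mX').
    + by have := read; move: gsum => /=; lia.
    + exact: almost_chain_fuse1.
  rewrite eS /= combine_front.
  have gm := @segmented_fuse _ _ _ [::] x y Q _ gQ.
  exists (fuse x y ++ Q), m; split=> //; first by rewrite catA.
  have [Q0|Qn] := posnP (size Q); last first.
    by have [z -> az] := almost_chain_front aQ (or_introl Qn).
  move/size0nil: Q0 => ->; rewrite cats0; apply: almost_chain_fuse1.
  by move: posS; rewrite eS /= => /andP[].
(* An index other than 1 rules out a reset, so the query takes place at the first match and the left
   sum is at most the right one. *)
have noreset P x y R : S = rcons P x ++ y :: R -> chain (sizes (rcons P x)) ->
  last 0 (keys (sizes (rcons P x))) = y.1 ->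
  [/\ next_index (sizes S) = (size P).+1,
      sumn (sizes (rcons P x)) <= y.1 + sumn (sizes R),
      combine S (next_index (sizes S)) = P ++ fuse x y ++ R
    & almost_chain (P ++ fuse x y)].
  move=> e c la.
  have ei : next_index (sizes S) =
    if y.1 + sumn (sizes R) < sumn (sizes (rcons P x)) then 1 else (size P).+1.
    move: c la; rewrite e sizes_cat sizes_rcons /= => c la.
    by rewrite index_weak // size_map.
  move: iN1; rewrite {1}ei; case: ltnP => // l _.
  move: ei; rewrite ltnNge l /= => ei; split=> //.
    by rewrite ei e cat_rcons combine_cat.
  exact: almost_chain_fuse.
case: aQ => [cQ|]; last first.
  case=> Q0 [y [eQ s0 c la]]; case/lastP: Q0 eQ s0 c la => // P x eQ _ c la.
  have eS' : S = rcons P x ++ y :: singles X m by rewrite eS eQ cat_rcons.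
  have [_ _ -> aQ] := noreset P x y _ eS' c la.
  exists (P ++ fuse x y), m; split=> //; first by rewrite -catA.
  rewrite -[_ ++ _]cats0 -catA; apply: segmented_fuse.
  by rewrite -!cat_rcons cats0 -eQ.
case: (ltnP m (size X)) => mX'; last first.
  case/negP: iN1; rewrite eS singles_nil // cats0.
  rewrite index_chain ?chain_pos //; last by case/and3P: cQ.
  by move: ib; rewrite eS singles_nil // cats0; case: (Q) => //=; rewrite ltn0 andbF.
set u := (1, nth false X m).
have gu := segmented_rcons gQ mX'.
(* If the last key is 1, the next letter matches the last block. Otherwise that letter prolongs the
   chain and matches the letter after it. *)
have [kQ|kQ] := boolP ((Q != [::]) && (last 0 (keys (sizes Q)) == 1)).
  case/andP: kQ; case/lastP: Q eS gQ cQ gsum gu => // P x eS gQ cQ gsum gu _ /eqP la.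
  rewrite singles_cons // in eS.
  have [_ sm -> aQ] := noreset P x u _ eS cQ la.
  exists (P ++ fuse x u), m.+1; split=> //; first by rewrite -catA.
    rewrite -[_ ++ _]cats0 -catA; apply: segmented_fuse.
    by rewrite -!cat_rcons cats0.
  by move: sm; rewrite sumn_singles /u /= => sm; have := read; lia.
have cu : chain (sizes (rcons Q u)).
  rewrite sizes_rcons; have [->|s0] := eqVneq Q [::]; first by rewrite chain1.
  have s0' : sizes Q != [::] by rewrite -size_eq0 size_map size_eq0.
  rewrite chain_rcons // cQ /u /=.
  move: kQ; rewrite s0 /= => kQ; rewrite ltn_neqAle eq_sym kQ /=.
  case/lastP: Q s0 s0' cQ {kQ eS gQ gsum gu} => // P x _ _ cQ.
  rewrite sizes_rcons in cQ *.
  have [->|sP] := eqVneq (sizes P) [::]; first by rewrite /= expn_gt0.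
  by rewrite last_keys_rcons //; move: (chain_pos cQ); rewrite all_rcons => /andP[].
have eS' : S = rcons Q u ++ singles X m.+1 by rewrite eS singles_cons // cat_rcons.
case: (ltnP m.+1 (size X)) => mX2; last first.
  case/negP: iN1; rewrite eS' singles_nil // cats0.
  rewrite index_chain ?chain_pos //; last by case/and3P: cu.
  by rewrite sizes_rcons -size_eq0 size_rcons.
have la : last 0 (keys (sizes (rcons Q u))) = 1.
  rewrite sizes_rcons; case: (sizes Q) => //= a s; exact: last_rcons.
rewrite (singles_cons mX2) in eS'.
have [_ sm -> aQ] := noreset Q u _ _ eS' cu la.
exists (Q ++ fuse u (1, nth false X m.+1)), m.+2; split=> //.
- by rewrite -catA.
- rewrite -[_ ++ _]cats0 -catA; apply: segmented_fuse.
  by rewrite -!cat_rcons cats0; apply: segmented_rcons.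
- move: sm; rewrite sumn_singles sizes_rcons sumn_rcons /u /= => sm.
  by have := read; lia.
Qed.

(** Every query shortens the list, and the letters beyond [n2] are still in it at the end. *)
Lemma steps_reachable v X n2 fuel S :
  (forall m, m <= size X -> (walk v X m <= Z.of_nat (size X - m))%Z ->
     m + 2 <= n2) ->
  reachable v X n2 S ->
  steps fuel S + (size X - n2) <= size S.
Proof.
move=> F2; elim: fuel S => [|fuel IH] S rS /=; last first.
  case: ifP => [act|_]; last by case: rS => Q [m [-> *]];
    rewrite size_cat size_singles; lia.
  have [r l] := reachable_combine F2 rS act.
  by have := IH _ r; lia.
by case: rS => Q [m [-> *]]; rewrite size_cat size_singles; lia.
Qed.

(** * The binary counter *)

(* Blocks of size 2^l and value u are stored as (l, u), the last block of the
   algorithm's list first; the second component counts the cancelled pairs. *)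
Fixpoint push (l : nat) (u : bool) (st : seq block) : seq block * nat :=
  if st is b :: st' then
    if b.1 == l then
      if b.2 == u then push l.+1 u st' else (st', 1)
    else ((l, u) :: st, 0)
  else ([:: (l, u)], 0).

Fixpoint run (l : nat) (st : seq block) (Y : seq bool) : nat :=
  if Y is u :: Y' then (push l u st).2 + run l (push l u st).1 Y' else 0.

Fixpoint mixed (Y : seq bool) : nat :=
  if Y is x :: y :: Y' then (x != y) + mixed Y' else 0.

Fixpoint compress (Y : seq bool) : seq bool :=
  if Y is x :: y :: Y' then
    if x == y then x :: compress Y' else compress Y'
  else [::].

Fixpoint cancels (k : nat) (Y : seq bool) : nat :=
  if k is k'.+1 then mixed Y + cancels k' (compress Y) else 0.

Lemma push_le1 l u st : (push l u st).2 <= 1.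
Proof.
elim: st l => //= b st IH l.
by case: ifP => // _; case: ifP.
Qed.

Lemma push_level l u st j : j <= l -> all (fun b => j <= b.1) st ->
  all (fun b => j <= b.1) (push l u st).1.
Proof.
elim: st l => [|b st IH] l jl /=; first by rewrite jl.
case/andP=> jb js; case: ifP => _; last by rewrite /= jl jb js.
by case: ifP => // _; apply: IH => //; lia.
Qed.

Lemma seq_ind2 (T : Type) (P : seq T -> Prop) :
  P [::] -> (forall x, P [:: x]) ->
  (forall x y s, P s -> P (x :: y :: s)) -> forall s, P s.
Proof.
move=> P0 P1 P2 s; suff [] : P s /\ forall x, P (x :: s) by [].
by elim: s => [|y s [IH1 IH2]]; split=> // x; apply: P2.
Qed.

(** With all stored blocks above level [l], letters meet in pairs at level [l]: an unequal pair
    cancels, an equal pair sends one letter to level [l.+1]. What reaches the next level is exactly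
    [compress Y]. *)
Lemma run_level l st Y : all (fun b => l < b.1) st ->
  run l st Y = mixed Y + run l.+1 st (compress Y).
Proof.
have push_top u (s : seq block) : all (fun b => l < b.1) s ->
  push l u s = ((l, u) :: s, 0).
  by case: s => //= b s /andP[h _]; rewrite gtn_eqF.
elim/seq_ind2: Y st => [//|x|x y Y IH] st hst /=.
  by rewrite push_top.
rewrite push_top //= eqxx; case: eqP => [->|_] /=.
  by rewrite IH ?push_level // !add0n addnCA.
by rewrite IH // add0n addnA.
Qed.

Lemma cancels_le_run k l Y : cancels k Y <= run l [::] Y.
Proof.
elim: k l Y => //= k IH l Y.
by rewrite run_level // leq_add2l.
Qed.

(** * The algorithm simulates the binary counter before any reset *)

Definition dyadic (b : block) : block := (2 ^ b.1, b.2).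
Definition counter (st : seq block) : seq block := rev (map dyadic st).

Lemma counter_cons b st : counter (b :: st) = rcons (counter st) (dyadic b).
Proof. by rewrite /counter /= rev_cons. Qed.

Lemma size_counter st : size (counter st) = size st.
Proof. by rewrite /counter size_rev size_map. Qed.

Lemma sizes_counter st :
  sizes (counter st) = rev (map (expn 2) (map fst st)).
Proof. by rewrite /sizes /counter map_rev -!map_comp. Qed.

Lemma keys_pow2 s : all pow2 s -> keys s = s.
Proof. by case: s => //= x s /andP[/eqP <-]. Qed.

Lemma counter_pow2 st : all pow2 (sizes (counter st)).
Proof.
by rewrite sizes_counter all_rev !all_map; apply/allP => b _ /=;
  rewrite /pow2 pfactorK.
Qed.

Lemma counter_chain st : sorted ltn (map fst st) -> chain (sizes (counter st)).
Proof.
move=> so; have p2 := counter_pow2 st.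
rewrite /chain keys_pow2 //; apply/and3P; split.
- by rewrite sizes_counter all_rev !all_map; apply/allP => b _ /=;
    rewrite expn_gt0.
- by case: (sizes _) p2 => //= x s /andP[].
rewrite sizes_counter rev_sorted.
have mono : {homo expn 2 : x y / ltn x y >-> ltn x y}.
  by move=> x y xy; rewrite /= ltn_exp2l.
exact: (homo_sorted mono _ so).
Qed.

Lemma counter_almost_chain st l u :
  sorted ltn (map fst st) -> all (fun b => l <= b.1) st ->
  almost_chain (rcons (counter st) (dyadic (l, u))).
Proof.
case: st => [|b st] so /=; first by left; rewrite /= chain1 expn_gt0.
case/andP; rewrite leq_eqVlt => /orP[/eqP e|lb] _; last first.
  by left; rewrite -counter_cons; apply: counter_chain; rewrite /= lb.
right; exists (counter (b :: st)), (dyadic (l, u)); split=> //.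
- by rewrite -size_eq0 size_counter.
- exact: counter_chain.
by rewrite keys_pow2 ?counter_pow2 // counter_cons sizes_rcons last_rcons /= e.
Qed.

Lemma sum_distinct_pow2 a s : path ltn a s ->
  sumn (map (expn 2) s) + 2 ^ a.+1 <= 2 * 2 ^ last a s.
Proof.
elim: s a => [|b s IH] a /=; first by rewrite expnS.
case/andP=> ab /IH; have : 2 ^ a.+1 <= 2 ^ b by rewrite leq_exp2l.
rewrite [2 ^ b.+1]expnS; lia.
Qed.

Lemma sum_distinct_pow2_le s e : sorted ltn s -> all (fun l => 2 ^ l <= e) s ->
  sumn (map (expn 2) s) <= 2 * e.
Proof.
case: s => //= a s so ha; have := sum_distinct_pow2 so.
have : 2 ^ last a s <= e by apply: (allP (ha : all _ (a :: s))); exact: mem_last.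
rewrite expnS; lia.
Qed.

Definition minority v (Q : seq block) : seq block := [seq b <- Q | b.2 != v].

(** A block of the minority value is a drop of the walk by its size, hence at most [e]. The net
    increase is the majority total minus the minority total. *)
Lemma segmented_minority v X e c Q m :
  (forall a b, a <= b -> b <= size X ->
     (walk v X a <= walk v X b + Z.of_nat e)%Z) ->
  m <= size X -> segmented v X c Q m ->
  all (fun b => b.1 <= e) (minority v Q) /\
  (Z.of_nat (sumn (sizes Q)) = walk v X m - walk v X c
     + 2 * Z.of_nat (sumn (sizes (minority v Q))))%Z.
Proof.
move=> F1 mX; elim: Q c => [|b Q IH] c /=; first by case=> _ ->; split=> //; lia.
case=> c' [cc' e1 g]; have [h1 h2] := IH _ g.
have c'm := segmented_le g.
have := F1 _ _ cc' (leq_trans c'm mX); move: e1; rewrite /weight.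
by case: eqP => _ /= e1 e2; rewrite ?h1 ?andbT; split=> //; lia.
Qed.

Lemma counter_sum v X e st b m :
  (forall a b, a <= b -> b <= size X ->
     (walk v X a <= walk v X b + Z.of_nat e)%Z) ->
  m <= size X -> sorted ltn (map fst st) ->
  segmented v X 0 (rcons (counter st) b) m ->
  (Z.of_nat (sumn (sizes (counter st))) <= walk v X m + 6 * Z.of_nat e)%Z.
Proof.
move=> F1 mX so g; have [] := segmented_minority F1 mX g.
rewrite walk0 /minority filter_rcons -/(minority v _).
have em : minority v (counter st) = counter (minority v st).
  by rewrite /minority /counter filter_rev filter_map.
have bound : all (fun b => b.1 <= e) (minority v (counter st)) ->
    sumn (sizes (minority v (counter st))) <= 2 * e.
  rewrite em sizes_counter sumn_rev /counter all_rev all_map => h.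
  apply: sum_distinct_pow2_le; last by rewrite all_map.
  apply: (subseq_sorted ltn_trans _ so).
  exact: map_subseq (filter_subseq _ _).
rewrite sizes_rcons sumn_rcons.
case: ifP => _; last by move=> /bound; lia.
rewrite all_rcons sizes_rcons sumn_rcons => /andP[hb /bound]; lia.
Qed.

(** The block [(l, u)] is being pushed into the counter [st]. A query shortens the list by one, and
    by two when a pair cancels; each cancellation thus saves one query. After [n1] letters
    [steps_reachable] takes over, and the final 1 pays for a push still in progress. *)
Lemma steps_counter v X n1 n2 e :
  (forall a b, a <= b -> b <= size X ->
     (walk v X a <= walk v X b + Z.of_nat e)%Z) ->
  (forall m, m <= size X -> (walk v X m <= Z.of_nat (size X - m))%Z ->
     m + 2 <= n2) ->
  (forall m, m <= n1 ->
     (walk v X m + 8 * Z.of_nat e <= Z.of_nat (size X - m))%Z) ->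
  n1 <= size X ->
  forall n fuel st l u m,
  let S := counter st ++ dyadic (l, u) :: singles X m in
  fuel + (size X - m) <= n -> size S <= fuel ->
  segmented v X 0 (rcons (counter st) (dyadic (l, u))) m ->
  m <= size X -> m <= n2 ->
  sorted ltn (map fst st) -> all (fun b => l <= b.1) st ->
  steps fuel S + (size X - n2) + (push l u st).2
    + run 0 (push l u st).1 (drop m (take n1 X)) <= size S + 1.
Proof.
move=> F1 F2 F3 n1X; elim=> [|n IH] fuel st l u m S.
  by rewrite /S size_cat /=; lia.
move=> hn hfuel g mX mn so hl.
have szS : size S = size st + 1 + (size X - m).
  by rewrite /S size_cat /= size_counter size_singles; lia.
case: (leqP n1 m) => [n1m|mn1].
  rewrite drop_oversize /=; last by rewrite size_takel.
  have r : reachable v X n2 S.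
    exists (rcons (counter st) (dyadic (l, u))), m; split=> //.
      by rewrite cat_rcons.
    exact: counter_almost_chain.
  have := steps_reachable fuel F2 r; have := push_le1 l u st; lia.
have n12 : n1 <= n2 by have := F3 n1 (leqnn _); have := F2 n1 n1X; lia.
have mX' : m < size X by lia.
have eY : drop m (take n1 X) = nth false X m :: drop m.+1 (take n1 X).
  by rewrite (drop_nth false) ?nth_take // size_takel.
have next st' fuel' : fuel' + (size X - m) <= n.+1 ->
  size st' + (size X - m) <= fuel' ->
  segmented v X 0 (counter st') m -> sorted ltn (map fst st') ->
  steps fuel' (counter st' ++ singles X m) + (size X - n2)
    + run 0 st' (drop m (take n1 X)) <= size st' + (size X - m) + 1.
  move=> h1 h2 h3 h4; rewrite eY singles_cons //=.
  have := IH fuel' st' 0 (nth false X m) m.+1.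
  rewrite /= size_cat /= size_counter size_singles /dyadic /= expn0.
  rewrite addnA => /(_ _ _ _ mX' _ h4).
  move=> H; apply: leq_trans (H _ _ _ _ _) _; try lia.
    exact: segmented_rcons.
  by apply/allP.
(* Without a carry the block joins the counter and no query is made; only the next letter is read.
   For this reason the induction is on fuel plus unread letters. *)
have [carry|nocarry] := boolP ((st != [::]) && ((head (0, false) st).1 == l));
    last first.
  have ep : push l u st = ((l, u) :: st, 0).
    by case: (st) nocarry => //= b st' /negbTE ->.
  have so' : sorted ltn (map fst ((l, u) :: st)).
    case: (st) so hl nocarry => //= b st' -> /andP[h _] nc.
    by rewrite ltn_neqAle eq_sym nc h.
  have := next ((l, u) :: st) fuel; rewrite counter_cons cat_rcons ep => H.
  have := H _ _ g so'; rewrite -/S /= szS; lia.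
have eS : S = counter st ++ dyadic (l, u) :: singles X m by [].
case: st S eS so hl carry g hfuel szS
  => // -[l' w] st S eS so hl /= /eqP el g hfuel szS.
subst l'; rewrite eqxx.
case: fuel hn hfuel => [|fuel] hn hfuel; first by lia.
have so' : sorted ltn (map fst st) by exact: path_sorted so.
have cs := counter_sum F1 mX so g.
(* The margin 8e covers the 6e of [counter_sum]: the processed blocks weigh at most as much as the
   unread letters, which makes the loop active and prevents a reset. *)
have f3 := F3 m (ltnW mn1).
rewrite counter_cons in eS.
have csm : sumn (sizes (counter ((l, w) :: st))) <= size X - m.
  by apply/leP/Nat2Z.inj_le; apply: (Z.le_trans _ _ _ cs); lia.
have act : active (sizes S).
  rewrite /active eS -counter_cons sizes_cat.
  case E: (counter _) csm => [|b Q] csm.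
    by move/(congr1 size): E; rewrite size_counter.
  rewrite /= sumn_cat /= sumn_singles; move: csm => /=; lia.
have ei : next_index (sizes S) = (size (counter st)).+1.
  have e1 : rcons (sizes (counter st)) (2 ^ l) = sizes (counter ((l, w) :: st)).
    by rewrite counter_cons sizes_rcons.
  rewrite eS -[size _](size_map fst) sizes_cat sizes_rcons /= index_weak e1.
  - by rewrite sumn_singles; case: ltnP => //; lia.
  - exact: counter_chain.
  by rewrite keys_pow2 ?counter_pow2 // counter_cons sizes_rcons last_rcons.
have -> : steps fuel.+1 S =
    (steps fuel (counter st ++ fuse (dyadic (l, w)) (dyadic (l, u))
                   ++ singles X m)).+1.
  by rewrite /= act ei eS cat_rcons combine_cat.
have gm : segmented v X 0
    (counter st ++ fuse (dyadic (l, w)) (dyadic (l, u))) m.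
  rewrite -[_ ++ _]cats0 -catA; apply: segmented_fuse.
  by rewrite -!cat_rcons cats0 -counter_cons.
rewrite szS; move: hn hfuel; rewrite szS /= => hn hfuel.
move: gm; rewrite /fuse /=; case: eqP => [<-|_] gm.
  have ed : (2 ^ l + 2 ^ l, w) = dyadic (l.+1, w).
    by rewrite /dyadic /= addnn expnS mul2n.
  rewrite ed cats1 in gm *.
  have := IH fuel st l.+1 w m; rewrite /= size_cat /= size_counter size_singles.
  have lst : all (fun b => l.+1 <= b.1) st.
    by move: so; rewrite /= (path_sortedE ltn_trans) => /andP[+ _]; rewrite all_map.
  have h1 : fuel + (size X - m) <= n by lia.
  have h2 : size st + (size X - m).+1 <= fuel by lia.
  move=> /(_ h1 h2 gm mX mn so' lst); rewrite /dyadic /=; lia.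
rewrite ltnn cats0 in gm *.
have h1 : fuel + (size X - m) <= n.+1 by lia.
have h2 : size st + (size X - m) <= fuel by lia.
by have := next st fuel h1 h2 gm so'; rewrite /=; lia.
Qed.

(** The deterministic half of the proof. The three hypotheses on the walk say that it never drops by
    more than [e], that reading stops by [n2], and that no reset occurs before [n1]. The simulation
    starts with the first letter pending on an empty counter. *)
Lemma C_GP_le v X n1 n2 e k :
  (forall a b, a <= b -> b <= size X ->
     (walk v X a <= walk v X b + Z.of_nat e)%Z) ->
  (forall m, m <= size X -> (walk v X m <= Z.of_nat (size X - m))%Z ->
     m + 2 <= n2) ->
  (forall m, m <= n1 ->
     (walk v X m + 8 * Z.of_nat e <= Z.of_nat (size X - m))%Z) ->
  n1 <= size X -> 0 < size X ->
  C_GP X + (size X - n2) + cancels k (take n1 X) <= size X + 1.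
Proof.
move=> F1 F2 F3 n1X X0.
apply: leq_trans (_ : C_GP X + (size X - n2) + run 0 [::] (take n1 X) <= _).
  by rewrite leq_add2l cancels_le_run.
rewrite C_GP_steps singles_cons //.
have F20 := F2 0 (leq0n _); rewrite walk0 in F20.
have hn2 : 1 <= n2 by lia.
have g : segmented v X 0 [:: dyadic (0, nth false X 0)] 1.
  by rewrite /dyadic /= expn0; apply: (@segmented_rcons _ _ _ [::]).
have hf : size (dyadic (0, nth false X 0) :: singles X 1) <= size X.
  by rewrite /= size_singles; lia.
have := @steps_counter v X n1 n2 e F1 F2 F3 n1X _ (size X) [::] 0
  (nth false X 0) 1 (leqnn _) hf g X0 hn2 isT isT.
rewrite /dyadic /= expn0 addn0 size_singles => H.
apply: leq_trans (leq_trans H _); last by lia.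
rewrite leq_add2l; case: n1 n1X {F3 H} => [|n1] n1X; first by rewrite take0.
rewrite -{1}(drop0 (take n1.+1 X)) (drop_nth false) ?size_takel //=.
by rewrite nth_take.
Qed.

(** * Expectations over strings with prescribed counts *)

Open Scope R_scope.

Definition ones (X : seq bool) : nat := count (fun b : bool => b) X.

(* Expectation of [g] on a uniformly random string of length [n] with [a] ones,
   revealed from left to right; junk unless [a <= n]. *)
Fixpoint Ex (n a : nat) (g : seq bool -> R) : R :=
  if n is n'.+1 then
    (1 - INR a / INR n) * Ex n' a (fun X => g (false :: X))
    + INR a / INR n * Ex n' a.-1 (fun X => g (true :: X))
  else g [::].

Fixpoint tot (n : nat) (g : seq bool -> R) : R :=
  if n is n'.+1 then
    tot n' (fun X => g (false :: X)) + tot n' (fun X => g (true :: X))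
  else g [::].

Lemma ExS n a g : Ex n.+1 a g =
  (1 - INR a / INR n.+1) * Ex n a (fun X => g (false :: X))
  + INR a / INR n.+1 * Ex n a.-1 (fun X => g (true :: X)).
Proof. by []. Qed.

Lemma totS n g : tot n.+1 g =
  tot n (fun X => g (false :: X)) + tot n (fun X => g (true :: X)).
Proof. by []. Qed.

Lemma INRD m n : INR (m + n)%N = INR m + INR n.
Proof. exact: plus_INR. Qed.

Lemma INRM m n : INR (m * n)%N = INR m * INR n.
Proof. exact: mult_INR. Qed.

Lemma INR_leq m n : (m <= n)%N -> INR m <= INR n.
Proof. by move=> /leP; apply: le_INR. Qed.

Lemma INRS_gt0 n : 0 < INR n.+1.
Proof. exact: lt_0_INR (Nat.lt_0_succ n). Qed.

Lemma ratio_bounds a n : (a <= n.+1)%N -> 0 <= INR a / INR n.+1 <= 1.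
Proof.
move=> /INR_leq h; have n0 := INRS_gt0 n; have a0 := pos_INR a; split.
  by apply: Rmult_le_pos => //; left; apply: Rinv_0_lt_compat.
by apply: (Rmult_le_reg_r (INR n.+1)) => //; rewrite Rmult_1_l /Rdiv Rmult_assoc
  Rinv_l ?Rmult_1_r //; apply: Rgt_not_eq.
Qed.

Lemma ratio_refl n : INR n.+1 / INR n.+1 = 1.
Proof. by rewrite /Rdiv Rinv_r //; apply: Rgt_not_eq; exact: INRS_gt0. Qed.

Lemma ones_le X : (ones X <= size X)%N.
Proof. exact: count_size. Qed.

Lemma Ex_le n a g h : (a <= n)%N ->
  (forall X, size X = n -> ones X = a -> g X <= h X) ->
  Ex n a g <= Ex n a h.
Proof.
elim: n a g h => [|n IH] a g h an H.
  by apply: H => //; move: an; rewrite leqn0 => /eqP ->.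
have [p0 p1] := ratio_bounds an.
rewrite !ExS.
apply: Rplus_le_compat.
  (* At [a = n.+1] the branch [false], and at [a = 0] the branch [true], asks for an impossible
     count; its junk value has weight 0. *)
  move: an; rewrite leq_eqVlt => /orP[/eqP ->|an].
    by rewrite ratio_refl Rminus_diag !Rmult_0_l; right.
  apply: Rmult_le_compat_l; first lra.
  by apply: IH => // X sX oX; apply: H; rewrite /= ?sX.
case: a an H p0 p1 => [|a] an H p0 p1.
  by rewrite /Rdiv !Rmult_0_l; right.
apply: Rmult_le_compat_l => //.
by apply: IH => // X sX /= oX; apply: H; rewrite -?oX //= sX.
Qed.

Lemma Ex_eq n a g h : (a <= n)%N ->
  (forall X, size X = n -> ones X = a -> g X = h X) ->
  Ex n a g = Ex n a h.
Proof.
by move=> an H; apply: Rle_antisym; apply: Ex_le => // X sX oX;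
  rewrite H //; right.
Qed.

Lemma Ex_ext n a g h : (forall X, g X = h X) -> Ex n a g = Ex n a h.
Proof.
elim: n a g h => [|n IH] a g h H; first exact: H.
by rewrite !ExS; congr (_ * _ + _ * _); apply: IH => X; apply: H.
Qed.

Lemma Ex_linear n a c g h :
  Ex n a (fun X => c * g X + h X) = c * Ex n a g + Ex n a h.
Proof. by elim: n a g h => //= n IH a g h; rewrite !IH; ring. Qed.

Lemma Ex_const n a c : Ex n a (fun=> c) = c.
Proof. by elim: n a => //= n IH a; rewrite !IH; ring. Qed.

Lemma Ex_scale n a c g : Ex n a (fun X => c * g X) = c * Ex n a g.
Proof. by elim: n a g => //= n IH a g; rewrite !IH; ring. Qed.

Lemma tot_eq n g h : (forall X, size X = n -> g X = h X) -> tot n g = tot n h.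
Proof.
elim: n g h => [|n IH] g h H /=; first exact: H.
by congr (_ + _); apply: IH => X sX; apply: H; rewrite /= sX.
Qed.

Lemma tot_add n g h : tot n (fun X => g X + h X) = tot n g + tot n h.
Proof. by elim: n g h => //= n IH g h; rewrite !IH; ring. Qed.

Lemma tot_scale n c g : tot n (fun X => c * g X) = c * tot n g.
Proof. by elim: n g => //= n IH g; rewrite !IH; ring. Qed.

Lemma tot0 n g : (forall X, size X = n -> g X = 0) -> tot n g = 0.
Proof.
elim: n g => [|n IH] g H /=; first exact: H.
by rewrite !IH ?Rplus_0_r // => X sX; apply: H; rewrite /= sX.
Qed.

Lemma tot_ge0 n g : (forall X, 0 <= g X) -> 0 <= tot n g.
Proof. by elim: n g => //= n IH g H; apply: Rplus_le_le_0_compat; apply: IH. Qed.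

Lemma tot_cat m n g :
  tot (m + n) g = tot m (fun Y => tot n (fun Z => g (Y ++ Z))).
Proof. by elim: m g => //= m IH g; rewrite !IH. Qed.

(** The absorption identity makes 'C(n, a) / 'C(n.+1, a.+1) the probability that the first letter is
    a one, so revealing letters in turn agrees with counting strings. *)
Lemma tot_Ex n a g : (a <= n)%N ->
  tot n (fun X => if ones X == a then g X else 0) = INR 'C(n, a) * Ex n a g.
Proof.
elim: n a g => [|n IH] a g an.
  by move: an; rewrite leqn0 => /eqP -> /=; rewrite Rmult_1_l.
rewrite ExS totS.
case: a an => [|a] an.
  rewrite (tot0 (n := n) (g := fun X => if ones (true :: X) == 0%N then g (true :: X) else 0)) //.
  rewrite (IH 0%N) // !bin0 [INR 0]/= /Rdiv !Rmult_0_l; ring.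
have n0 := INRS_gt0 n.
have e : INR 'C(n, a) * INR n.+1 = INR 'C(n.+1, a.+1) * INR a.+1.
  by rewrite -!INRM mulnC (mul_bin_diag n.+1 a) mulnC.
have e2 : INR 'C(n.+1, a.+1) = INR 'C(n, a.+1) + INR 'C(n, a).
  by rewrite binS INRD.
rewrite (tot_eq (n := n) (g := fun X => if ones (true :: X) == a.+1 then g (true :: X) else 0)
  (h := fun X => if ones X == a then g (true :: X) else 0)) // (IH a) //.
set x := Ex n a _.
have -> : INR 'C(n, a) = INR 'C(n.+1, a.+1) * (INR a.+1 / INR n.+1).
  by apply: (Rmult_eq_reg_r (INR n.+1)); [rewrite e; field|]; lra.
have e3 : INR 'C(n, a.+1) = INR 'C(n.+1, a.+1) * (1 - INR a.+1 / INR n.+1).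
  apply: (Rmult_eq_reg_r (INR n.+1)); last by lra.
  rewrite e2; field_simplify; last by lra.
  by move: e; rewrite e2 => e; nra.
move: an; rewrite leq_eqVlt => /orP[/eqP ->|an]; last first.
  by rewrite (IH a.+1) // e3; ring.
rewrite tot0 ?ratio_refl; first by ring.
move=> X sX; case: eqP => // oX; have := ones_le X.
by rewrite -[ones X]/(ones (false :: X)) oX sX ltnn.
Qed.

Lemma size_filter_all_strings n (p : pred (seq bool)) :
  INR (size [seq X <- all_strings n | p X]) = tot n (fun X => if p X then 1 else 0).
Proof.
rewrite size_filter; elim: n p => [|n IH] p /=; first by case: (p _).
by rewrite !count_cat !count_map /= addn0 INRD !IH.
Qed.

Lemma prob_uniform_Ex N A E : (A <= N)%N ->
  prob_uniform N A E = Ex N A (fun X => if E X then 1 else 0).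
Proof.
move=> AN; rewrite /prob_uniform -filter_predI !size_filter_all_strings.
have C0 : 0 < INR 'C(N, A).
  by apply: lt_0_INR; apply/ltP; rewrite bin_gt0.
rewrite (tot_eq (h := fun X => if ones X == A then if E X then 1 else 0 else 0)).
  rewrite (tot_eq (n := N) (g := fun X => if count _ X == A then 1 else 0)
    (h := fun X => if ones X == A then 1 else 0)) //.
  by rewrite !tot_Ex // Ex_const; field; lra.
by move=> X _ /=; rewrite andbC /ones; case: eqP.
Qed.

(** The weight depends only on the number of ones, so the sum splits into classes, each a
    nonnegative multiple of some [Ex n a h]. *)
Lemma tot_class n h (w : nat -> R) : (forall j, 0 <= w j) ->
  (forall a, (a <= n)%N -> Ex n a h <= 0) ->
  tot n (fun Y => w (ones Y) * h Y) <= 0.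
Proof.
move=> w0 H.
have partial j : tot n (fun Y => if (ones Y < j)%N then w (ones Y) * h Y else 0) <= 0.
  elim: j => [|j IH]; first by rewrite tot0 //; right.
  rewrite (tot_eq (h := fun Y =>
    (if (ones Y < j)%N then w (ones Y) * h Y else 0) +
    w j * (if ones Y == j then h Y else 0))); last first.
    move=> X _; rewrite ltnS leq_eqVlt; case: eqP => [->|_] /=.
      by rewrite ltnn Rplus_0_l.
    by rewrite Rmult_0_r Rplus_0_r.
  rewrite tot_add tot_scale.
  suff : tot n (fun Y => if ones Y == j then h Y else 0) <= 0.
    by move=> h1; have := w0 j; nra.
  have [jn|nj] := leqP j n.
    by rewrite tot_Ex //; have := H j jn; have := pos_INR 'C(n, j); nra.
  rewrite tot0; first by right.
  move=> X sX; case: eqP => // oX; have := ones_le X.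
  by rewrite oX sX leqNgt nj.
rewrite (tot_eq (h := fun Y => if (ones Y < n.+1)%N then w (ones Y) * h Y else 0)) //.
by move=> X sX; rewrite ltnS -sX ones_le.
Qed.

(** A prefix is uniform given its number of ones: its weight is the number of its completions, which
    depends on that number alone. *)
Lemma Ex_take N A n g c : (A <= N)%N -> (n <= N)%N ->
  (forall a, (a <= n)%N -> Ex n a g <= c) ->
  Ex N A (fun X => g (take n X)) <= c.
Proof.
move=> AN nN H.
have C0 : 0 < INR 'C(N, A) by apply: lt_0_INR; apply/ltP; rewrite bin_gt0.
suff : Ex N A (fun X => 1 * g (take n X) + - c) <= 0.
  by rewrite Ex_linear Ex_const; lra.
apply: (Rmult_le_reg_l (INR 'C(N, A))) => //; rewrite Rmult_0_r -tot_Ex //.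
rewrite -{1}(subnKC nN) tot_cat.
rewrite (tot_eq (h := fun Y =>
  tot (N - n) (fun Z => if (ones Y + ones Z)%N == A then 1 else 0) *
  (1 * g Y + - c))).
  apply: (@tot_class n (fun Y => 1 * g Y + - c)
    (fun j => tot (N - n) (fun Z => if (j + ones Z)%N == A then 1 else 0))).
    by move=> j; apply: tot_ge0 => Z; case: ifP => _; lra.
  by move=> a an; rewrite Ex_linear Ex_const; have := H a an; lra.
move=> Y sY; rewrite Rmult_comm -tot_scale; apply: tot_eq => Z _.
rewrite /ones count_cat; case: ifP => _; last by rewrite Rmult_0_r.
by rewrite take_size_cat // Rmult_1_r.
Qed.

(** * Uniformity after one round of pairing *)

Fixpoint leftover (X : seq bool) : nat :=
  match X with
  | [::] => 0
  | [:: x] => x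
  | _ :: _ :: X' => leftover X'
  end.

(** For given mixed count and leftover, every compressed string of the resulting length arises
    equally often; test functions [Phi] express this without a count. An equal pair prepends a
    letter to the compressed string, a mixed pair only raises [d]. *)
Lemma tot_compress m (Phi : nat -> nat -> seq bool -> R) :
  (forall d e k, tot k (Phi d e) <= 0) ->
  tot m (fun X => Phi (mixed X) (leftover X) (compress X)) <= 0.
Proof.
have [k mk] := ubnP m; elim: k m mk Phi => // k IH [|[|m]] mk Phi H /=.
- exact: (H 0%N 0%N 0%N).
- by have := H 0%N (nat_of_bool false) 0%N;
    have := H 0%N (nat_of_bool true) 0%N; rewrite /=; lra.
have mk' : (m < k)%N by lia.
have h1 := IH m mk' (fun d e Y => Phi d e (false :: Y) + Phi d e (true :: Y)).
have h2 : tot m (fun X => Phi (1 + mixed X)%N (leftover X) (compress X)) <= 0.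
  exact: (IH m mk' (fun d e Y => Phi d.+1 e Y) (fun d => H d.+1)).
rewrite tot_add in h1.
suff : tot m (fun X => Phi (0 + mixed X)%N (leftover X) (false :: compress X)) +
  tot m (fun X => Phi (0 + mixed X)%N (leftover X) (true :: compress X)) <= 0.
  by move: h2; lra.
by apply: h1; move=> d e j; rewrite tot_add; exact: (H d e j.+1).
Qed.

Lemma ones_compress X :
  ones X = (2 * ones (compress X) + mixed X + leftover X)%N.
Proof.
elim/seq_ind2: X => [//|[]//|x y X /=]; rewrite /ones /= => ->.
by case: x; case: y => /=; lia.
Qed.

Lemma size_compress X :
  (size X <= 2 * size (compress X) + 2 * mixed X + 1)%N /\
  (2 * size (compress X) + 2 * mixed X <= size X)%N.
Proof.
elim/seq_ind2: X => [//|x //|x y X /=] [].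
by case: x; case: y => /=; lia.
Qed.

Lemma leftover_size X :
  (leftover X <= size X - (2 * size (compress X) + 2 * mixed X))%N.
Proof.
elim/seq_ind2: X => [//|[]//|x y X /=].
by case: x; case: y => /=; lia.
Qed.

(** By [ones_compress] the number of ones of the input is fixed by the mixed count, the leftover and
    the number of ones after compression. So conditioning on it is a weight of the kind treated in
    [tot_class]. *)
Lemma Ex_compress m a h (w : nat -> R) : (a <= m)%N -> (forall d, 0 <= w d) ->
  (forall k b, (b <= k)%N -> Ex k b h <= 0) ->
  Ex m a (fun X => w (mixed X) * h (compress X)) <= 0.
Proof.
move=> am w0 H.
have C0 : 0 < INR 'C(m, a) by apply: lt_0_INR; apply/ltP; rewrite bin_gt0.
apply: (Rmult_le_reg_l (INR 'C(m, a))) => //; rewrite Rmult_0_r -tot_Ex //.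
rewrite (tot_eq (h := fun X => (fun d e Y =>
  (if (2 * ones Y + d + e)%N == a then w d else 0) * h Y)
    (mixed X) (leftover X) (compress X))).
  apply: (@tot_compress m (fun d e Y =>
    (if (2 * ones Y + d + e)%N == a then w d else 0) * h Y)) => d e k.
  apply: (@tot_class k h
    (fun j => if (2 * j + d + e)%N == a then w d else 0)) => [j|b bk].
    by case: ifP => _ //; lra.
  exact: H.
by move=> X _; rewrite ones_compress; case: ifP => _ //; rewrite Rmult_0_l.
Qed.

(** * Maximal inequality for the walk *)

(** The exponential is at most 1/(1-x), and (1-x)(1+x+2x^2) = 1 + x^2(1-2x) is at least 1. *)
Lemma exp_le_quadratic x : x <= / 2 -> exp x <= 1 + x + 2 * x ^ 2.
Proof.
move=> hx; have h := exp_ineq1_le (- x); have p := exp_pos x.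
have e : exp x * exp (- x) = 1 by rewrite -exp_plus Rplus_opp_r exp_0.
have h1 : exp x * (1 - x) <= 1 by rewrite -e; nra.
apply: (Rmult_le_reg_r (1 - x)); first lra.
by nra.
Qed.

Lemma exp_mono x y : x <= y -> exp x <= exp y.
Proof. by case=> [/exp_increasing|->]; lra. Qed.

(** For 0 <= a <= b the difference factors as (exp b - exp a)(1 - exp(-a-b)). *)
Lemma cosh_mono x y : Rabs x <= Rabs y ->
  exp x + exp (- x) <= exp y + exp (- y).
Proof.
have even z : exp z + exp (- z) = exp (Rabs z) + exp (- Rabs z).
  by rewrite /Rabs; case: Rcase_abs => _; rewrite ?Ropp_involutive //; ring.
rewrite (even x) (even y); move: (Rabs_pos x); set a := Rabs x; set b := Rabs y.
move=> a0 ab.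
have e1 : exp (- a) = exp b * exp (- a - b) by rewrite -exp_plus; congr exp; ring.
have e2 : exp (- b) = exp a * exp (- a - b) by rewrite -exp_plus; congr exp; ring.
have h1 : exp (- a - b) <= 1 by rewrite -exp_0; apply: exp_mono; lra.
have h2 := exp_mono ab; have h3 := exp_pos (- a - b).
by rewrite e1 e2; nra.
Qed.

Definition drift (theta : R) (n a : nat) : R :=
  theta * INR n - (2 * INR a - INR n).

(** Deviations are measured on suffixes because [Ex] reveals letters from the left: its parameters
    [n] and [a] then describe the unread part. *)
Fixpoint strays (theta D : R) (X : seq bool) : bool :=
  Rleb D (Rabs (drift theta (size X) (ones X)))
  || (if X is _ :: X' then strays theta D X' else false).

Lemma strays_cons theta D b X : strays theta D (b :: X) =
  Rleb D (Rabs (drift theta (size X).+1 (b + ones X))) || strays theta D X.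
Proof. by []. Qed.

Lemma RlebP x y : reflect (x <= y) (Rleb x y).
Proof. by rewrite /Rleb; case: Rle_dec => h; constructor. Qed.

(** The step is centred, so linear terms cancel; the quadratic ones add up to 8 l^2 p(1-p), at most
    2 l^2. *)
Lemma two_point_mgf p l : 0 <= p <= 1 -> 0 <= l <= / 4 ->
  (1 - p) * exp (- (2 * l * p)) + p * exp (2 * l * (1 - p)) <= exp (2 * l ^ 2) /\
  (1 - p) * exp (2 * l * p) + p * exp (- (2 * l * (1 - p))) <= exp (2 * l ^ 2).
Proof.
move=> hp hl.
have h0 := exp_ineq1_le (2 * l ^ 2).
have q : p * (1 - p) <= / 4 by have := pow2_ge_0 (p - / 2); nra.
have l2 : 0 <= l ^ 2 by nra.
split.
  have h1 : exp (- (2 * l * p)) <= 1 - 2 * l * p + 2 * (2 * l * p) ^ 2.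
    by have := @exp_le_quadratic (- (2 * l * p)) _; nra.
  have h2 : exp (2 * l * (1 - p)) <= 1 + 2 * l * (1 - p) + 2 * (2 * l * (1 - p)) ^ 2.
    by have := @exp_le_quadratic (2 * l * (1 - p)) _; nra.
  apply: Rle_trans h0.
  apply: (Rle_trans _ ((1 - p) * (1 - 2 * l * p + 2 * (2 * l * p) ^ 2) +
     p * (1 + 2 * l * (1 - p) + 2 * (2 * l * (1 - p)) ^ 2))).
    by apply: Rplus_le_compat; apply: Rmult_le_compat_l => //; lra.
  have -> : (1 - p) * (1 - 2 * l * p + 2 * (2 * l * p) ^ 2) +
     p * (1 + 2 * l * (1 - p) + 2 * (2 * l * (1 - p)) ^ 2) =
     1 + 8 * l ^ 2 * (p * (1 - p)) by ring.
  by nra.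
have h1 : exp (2 * l * p) <= 1 + 2 * l * p + 2 * (2 * l * p) ^ 2.
  by have := @exp_le_quadratic (2 * l * p) _; nra.
have h2 : exp (- (2 * l * (1 - p))) <= 1 - 2 * l * (1 - p) + 2 * (2 * l * (1 - p)) ^ 2.
  by have := @exp_le_quadratic (- (2 * l * (1 - p))) _; nra.
apply: Rle_trans h0.
apply: (Rle_trans _ ((1 - p) * (1 + 2 * l * p + 2 * (2 * l * p) ^ 2) +
   p * (1 - 2 * l * (1 - p) + 2 * (2 * l * (1 - p)) ^ 2))).
  by apply: Rplus_le_compat; apply: Rmult_le_compat_l => //; lra.
have -> : (1 - p) * (1 + 2 * l * p + 2 * (2 * l * p) ^ 2) +
   p * (1 - 2 * l * (1 - p) + 2 * (2 * l * (1 - p)) ^ 2) =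
   1 + 8 * l ^ 2 * (p * (1 - p)) by ring.
by nra.
Qed.

Lemma cosh_step p l B : 0 <= p <= 1 -> 0 <= l <= / 4 ->
  forall B0, Rabs B0 <= Rabs B ->
  (1 - p) * (exp (l * (B0 - 2 * p)) + exp (- (l * (B0 - 2 * p)))) +
  p * (exp (l * (B0 + 2 * (1 - p))) + exp (- (l * (B0 + 2 * (1 - p)))))
  <= (exp (l * B) + exp (- (l * B))) * exp (2 * l ^ 2).
Proof.
move=> hp hl B0 hB.
have [m1 m2] := two_point_mgf hp hl.
have c : exp (l * B0) + exp (- (l * B0)) <= exp (l * B) + exp (- (l * B)).
  by apply: cosh_mono; rewrite !Rabs_mult; apply: Rmult_le_compat_l => //; exact: Rabs_pos.
have e1 : exp (l * (B0 - 2 * p)) = exp (l * B0) * exp (- (2 * l * p)).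
  by rewrite -exp_plus; congr exp; ring.
have e2 : exp (- (l * (B0 - 2 * p))) = exp (- (l * B0)) * exp (2 * l * p).
  by rewrite -exp_plus; congr exp; ring.
have e3 : exp (l * (B0 + 2 * (1 - p))) = exp (l * B0) * exp (2 * l * (1 - p)).
  by rewrite -exp_plus; congr exp; ring.
have e4 : exp (- (l * (B0 + 2 * (1 - p)))) = exp (- (l * B0)) * exp (- (2 * l * (1 - p))).
  by rewrite -exp_plus; congr exp; ring.
rewrite e1 e2 e3 e4.
have x0 := exp_pos (l * B0); have y0 := exp_pos (- (l * B0)).
have z0 := exp_pos (2 * l ^ 2).
apply: (Rle_trans _ ((exp (l * B0) + exp (- (l * B0))) * exp (2 * l ^ 2))).
  have := Rmult_le_compat_l _ _ _ (Rlt_le _ _ x0) m1.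
  have := Rmult_le_compat_l _ _ _ (Rlt_le _ _ y0) m2.
  by lra.
by apply: Rmult_le_compat_r; lra.
Qed.

(* The hyperbolic cosine of the drift, suitably
   discounted, is a supermartingale up to the very last letter. *)
Lemma strays_bound theta D l n a : (a <= n)%N -> 0 <= l <= / 4 ->
  Ex n a (fun X => if strays theta D X then 1 else 0) <=
  (exp (l * drift theta n a) + exp (- (l * drift theta n a)))
    * exp (2 * l ^ 2 * INR n - l * D).
Proof.
move=> an hl.
(* Once the drift reaches [D] the right-hand side is at least 1, so nothing more need be
   followed. *)
have far k b : (b <= k)%N -> D <= Rabs (drift theta k b) ->
    Ex k b (fun X => if strays theta D X then 1 else 0) <=
    (exp (l * drift theta k b) + exp (- (l * drift theta k b)))
      * exp (2 * l ^ 2 * INR k - l * D).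
  move=> bk far; apply: (Rle_trans _ 1).
    apply: (Rle_trans _ (Ex k b (fun=> 1))); last by rewrite Ex_const; right.
    by apply: Ex_le => // X _ _; case: ifP => _; lra.
  apply: (Rle_trans _ (exp (l * Rabs (drift theta k b))
      * exp (2 * l ^ 2 * INR k - l * D))).
    rewrite -exp_plus -{1}exp_0; apply: exp_mono.
    by have := pos_INR k; have := pow2_ge_0 l; nra.
  apply: Rmult_le_compat_r; first by left; exact: exp_pos.
  have := exp_pos (l * drift theta k b); have := exp_pos (- (l * drift theta k b)).
  by rewrite /Rabs; case: Rcase_abs => _; rewrite ?Ropp_mult_distr_r_reverse; lra.
elim: n a an => [|n IH] a an.
  have [h|h] := RlebP D (Rabs (drift theta 0 a)); first exact: far.
  move: an h; rewrite leqn0 => /eqP -> h /=.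
  case: RlebP => // _ /=; apply: Rmult_le_pos; last by left; exact: exp_pos.
  by have := exp_pos (l * drift theta 0 0); have := exp_pos (- (l * drift theta 0 0)); lra.
have [h|h] := RlebP D (Rabs (drift theta n.+1 a)); first exact: far.
have n0 := INRS_gt0 n; have hp := ratio_bounds an.
set p := INR a / INR n.+1 in hp *.
have ep : INR a = p * INR n.+1 by rewrite /p; field; lra.
set B := drift theta n.+1 a.
set E := exp (2 * l ^ 2 * INR n - l * D).
have E0 : 0 < E by exact: exp_pos.
(* [B0] is the conditional mean of the drift after one more letter, closer to 0 than [B]. *)
pose B0 := B * (1 - / INR n.+1).
have hB : Rabs B0 <= Rabs B.
  rewrite /B0 Rabs_mult -{2}[Rabs B]Rmult_1_r.
  apply: Rmult_le_compat_l; first exact: Rabs_pos.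
  have i0 : 0 < / INR n.+1 by exact: Rinv_0_lt_compat.
  have i1 : / INR n.+1 <= 1.
    rewrite -Rinv_1; apply: Rinv_le_contravar; first lra.
    by rewrite S_INR; have := pos_INR n; lra.
  by rewrite Rabs_pos_eq; lra.
have eB0 : B0 = B - theta + 2 * p - 1.
  by rewrite /B0 /B /drift ep; field; lra.
have t1 : (1 - p) * Ex n a (fun X => if strays theta D (false :: X) then 1 else 0)
   <= (1 - p) * ((exp (l * (B0 - 2 * p)) + exp (- (l * (B0 - 2 * p)))) * E).
  move: an; rewrite leq_eqVlt => /orP[/eqP an|an].
    have -> : p = 1 by rewrite /p an ratio_refl.
    by rewrite Rminus_diag !Rmult_0_l; right.
  apply: Rmult_le_compat_l; first lra.
  have -> : B0 - 2 * p = drift theta n a.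
    by rewrite eB0 /B /drift S_INR; ring.
  apply: Rle_trans (IH a an); apply: Ex_le => // X sX oX.
  rewrite strays_cons sX oX add0n.
  by case: RlebP => // _; right.
have t2 : p * Ex n a.-1 (fun X => if strays theta D (true :: X) then 1 else 0)
   <= p * ((exp (l * (B0 + 2 * (1 - p))) + exp (- (l * (B0 + 2 * (1 - p))))) * E).
  have [a0|[b ab]] : a = 0%N \/ exists b, a = b.+1.
    by case: (a) => [|b]; [left|right; exists b].
    have p0 : p = 0 by rewrite /p a0 /Rdiv Rmult_0_l.
    by rewrite p0 !Rmult_0_l; right.
  apply: Rmult_le_compat_l; first lra.
  have bn : (b <= n)%N by rewrite ab in an.
  have -> : B0 + 2 * (1 - p) = drift theta n b.
    by rewrite eB0 /B /drift ab !S_INR; ring.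
  rewrite {1}ab; apply: Rle_trans (IH b bn); apply: Ex_le => // X sX oX.
  rewrite strays_cons sX oX add1n -ab.
  by case: RlebP => // _; right.
rewrite ExS -/p; have step := cosh_step hp hl hB.
apply: (Rle_trans _ _ _ (Rplus_le_compat _ _ _ _ t1 t2)).
have -> : exp (2 * l ^ 2 * INR n.+1 - l * D) = exp (2 * l ^ 2) * E.
  by rewrite /E -exp_plus S_INR; congr exp; ring.
have := Rmult_le_compat_r _ _ _ (Rlt_le _ _ E0) step.
by lra.
Qed.

(** The alternative [p = 0] covers transitions that are impossible at the boundary, where [y] need
    not be bounded. *)
Lemma weighted_exp_le p y u : 0 <= p -> (p = 0 \/ Rabs y <= 2) -> 0 <= u <= / 4 ->
  p * exp (- (u * y)) <= p * (1 - u * y + 8 * u ^ 2).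
Proof.
move=> p0 [->|hy] hu; first by lra.
apply: Rmult_le_compat_l => //.
have [y1 y2] : -2 <= y <= 2 by move: hy; rewrite /Rabs; case: Rcase_abs; lra.
have := @exp_le_quadratic (- (u * y)) _.
have : y ^ 2 <= 4 by nra.
have : 0 <= u ^ 2 by nra.
by nra.
Qed.

Lemma three_point_mgf p1 p2 p3 y1 y2 y3 u :
  0 <= p1 -> 0 <= p2 -> 0 <= p3 -> p1 + p2 + p3 = 1 ->
  p1 * y1 + p2 * y2 + p3 * y3 = 0 ->
  (p1 = 0 \/ Rabs y1 <= 2) -> (p2 = 0 \/ Rabs y2 <= 2) ->
  (p3 = 0 \/ Rabs y3 <= 2) -> 0 <= u <= / 4 ->
  p1 * exp (- (u * y1)) + p2 * exp (- (u * y2)) + p3 * exp (- (u * y3))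
    <= exp (8 * u ^ 2).
Proof.
move=> a1 a2 a3 s m b1 b2 b3 hu; apply: Rle_trans (exp_ineq1_le _).
have := weighted_exp_le a1 b1 hu; have := weighted_exp_le a2 b2 hu.
have := weighted_exp_le a3 b3 hu.
have e : p1 * (1 - u * y1 + 8 * u ^ 2) + p2 * (1 - u * y2 + 8 * u ^ 2)
  + p3 * (1 - u * y3 + 8 * u ^ 2) =
  (p1 + p2 + p3) * (1 + 8 * u ^ 2) - u * (p1 * y1 + p2 * y2 + p3 * y3) by ring.
by move: e; rewrite s m; lra.
Qed.

(** * Mixed pairs *)

Lemma mixed_cons x y X : mixed [:: x, y & X] = ((x != y) + mixed X)%N.
Proof. by []. Qed.

Lemma Ex_two_step u n a (m := INR n + 2)
    (G := fun X => exp (- (u * INR (mixed X)))) :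
  Ex n.+2 a G =
    (m - INR a) * (m - INR a - 1) / (m * (m - 1)) * Ex n a G
    + 2 * INR a * (m - INR a) / (m * (m - 1)) * (exp (- u) * Ex n a.-1 G)
    + INR a * (INR a - 1) / (m * (m - 1)) * Ex n a.-2 G.
Proof.
have n0 := pos_INR n.
have e x b : Ex n b (fun X => G [:: x, ~~ x & X]) = exp (- u) * Ex n b G.
  rewrite -Ex_scale; apply: Ex_ext => X.
  rewrite /G mixed_cons -exp_plus; congr exp.
  by case: x; rewrite add1n S_INR; ring.
rewrite !ExS.
have -> : Ex n a (fun X => G [:: false, false & X]) = Ex n a G by [].
have -> : Ex n a.-1.-1 (fun X => G [:: true, true & X]) = Ex n a.-2 G by [].
have eft : forall b, Ex n b (fun X => G [:: false, true & X]) = _ := e false.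
rewrite eft !S_INR /m.
case: a => [|a]; first by rewrite /=; field; lra.
by rewrite [a.+1.-1]/= S_INR; field; lra.
Qed.

(** Over one pair, the mixed count plus the potential x(M-x)/M changes by [y1], [y2] or [y3]. These
    have mean exactly 0 and size at most 2, so the pair costs a factor exp(8u^2), which the passage
    from [M] to [M + 2] provides. *)
Lemma mixed_step M x E1 E2 E3 u (m := M + 2)
    (U := fun z => exp (- (u * (z * (M - z) / M)) + 4 * u ^ 2 * M))
    (p1 := (m - x) * (m - x - 1) / (m * (m - 1)))
    (p2 := 2 * x * (m - x) / (m * (m - 1)))
    (p3 := x * (x - 1) / (m * (m - 1))) :
  1 <= M -> 0 <= x <= m -> 0 <= u <= / 4 ->
  p1 = 0 \/ x <= M /\ E1 <= U x ->
  p2 = 0 \/ E2 <= U (x - 1) ->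
  p3 = 0 \/ 2 <= x /\ E3 <= U (x - 2) ->
  p1 * E1 + p2 * (exp (- u) * E2) + p3 * E3 <=
    exp (- (u * (x * (m - x) / m)) + 4 * u ^ 2 * m).
Proof.
move=> M1 hx hu h1 h2 h3.
set h := x * (m - x) / m.
pose y1 := x * (M - x) / M - h.
pose y2 := 1 + (x - 1) * (M - (x - 1)) / M - h.
pose y3 := (x - 2) * (M - (x - 2)) / M - h.
pose K := exp (4 * u ^ 2 * M - u * h).
have K0 : 0 < K by exact: exp_pos.
have mm : 0 < m * (m - 1) by rewrite /m; nra.
have mM : 0 < M * m by rewrite /m; nra.
have P1 : 0 <= p1.
  case: h1 => [->|[xM _]]; first by right.
  by apply: Rle_mult_inv_pos => //; rewrite /m; nra.
have P2 : 0 <= p2 by apply: Rle_mult_inv_pos => //; nra.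
have P3 : 0 <= p3.
  case: h3 => [->|[xM _]]; first by right.
  by apply: Rle_mult_inv_pos => //; nra.
have b0 a c : 0 < c -> - (2 * c) <= a -> a <= 2 * c -> Rabs (a / c) <= 2.
  move=> c0 l r; apply: Rabs_le; split.
    by apply: (Rmult_le_reg_r c) => //; rewrite /Rdiv Rmult_assoc Rinv_l; lra.
  by apply: (Rmult_le_reg_r c) => //; rewrite /Rdiv Rmult_assoc Rinv_l; lra.
have B1 : p1 = 0 \/ Rabs y1 <= 2.
  case: h1 => [->|[xM _]]; [by left|right].
  have -> : y1 = (- 2 * x ^ 2) / (M * m) by rewrite /y1 /h /m; field; lra.
  by apply: b0 => //; rewrite /m; nra.
have B2 : p2 = 0 \/ Rabs y2 <= 2.
  right; have -> : y2 = (2 * (x * (m - x)) - m) / (M * m).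
    by rewrite /y2 /h /m; field; lra.
  have xb : 0 <= x * (m - x) by nra.
  have xb2 : 4 * (x * (m - x)) <= m ^ 2 by have := pow2_ge_0 (2 * x - m); nra.
  by apply: b0 => //; rewrite /m in hx xb xb2 *; nra.
have B3 : p3 = 0 \/ Rabs y3 <= 2.
  case: h3 => [->|[xM _]]; [by left|right].
  have -> : y3 = (- 2 * (m - x) ^ 2) / (M * m) by rewrite /y3 /h /m; field; lra.
  have : 0 <= m - x <= M by rewrite /m in hx *; lra.
  move: (m - x) => b hb; have : b ^ 2 <= M * m by rewrite /m; nra.
  by have := pow2_ge_0 b; move=> *; apply: b0 => //; lra.
have s : p1 + p2 + p3 = 1 by rewrite /p1 /p2 /p3 /m; field; lra.
have mean : p1 * y1 + p2 * y2 + p3 * y3 = 0.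
  by rewrite /p1 /p2 /p3 /y1 /y2 /y3 /h /m; field; lra.
have three := three_point_mgf P1 P2 P3 s mean B1 B2 B3 hu.
have k1 : p1 * E1 <= p1 * exp (- (u * y1)) * K.
  case: h1 => [->|[_ e]]; first by lra.
  rewrite Rmult_assoc; apply: Rmult_le_compat_l => //; apply: (Rle_trans _ _ _ e).
  by rewrite /U /K -exp_plus; right; congr exp; rewrite /y1; ring.
have k2 : p2 * (exp (- u) * E2) <= p2 * exp (- (u * y2)) * K.
  case: h2 => [->|e]; first by lra.
  rewrite Rmult_assoc; apply: Rmult_le_compat_l => //.
  apply: (Rle_trans _ (exp (- u) * U (x - 1))).
    by apply: Rmult_le_compat_l => //; left; exact: exp_pos.
  by rewrite /U /K -!exp_plus; right; congr exp; rewrite /y2; ring.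
have k3 : p3 * E3 <= p3 * exp (- (u * y3)) * K.
  case: h3 => [->|[_ e]]; first by lra.
  rewrite Rmult_assoc; apply: Rmult_le_compat_l => //; apply: (Rle_trans _ _ _ e).
  by rewrite /U /K -exp_plus; right; congr exp; rewrite /y3; ring.
apply: (Rle_trans _ (exp (8 * u ^ 2) * K)).
  by have := Rmult_le_compat_r _ _ _ (Rlt_le _ _ K0) three; lra.
by rewrite /K -exp_plus; right; congr exp; rewrite /m; ring.
Qed.

(* The potential a(m-a)/m is an exact martingale for the number of mixed pairs
   until the last pair, where it errs on the favourable side. *)
Lemma mixed_mgf u n a : (a <= n)%N -> 0 <= u <= / 4 ->
  Ex n a (fun X => exp (- (u * INR (mixed X)))) <=
  exp (- (u * (INR a * (INR n - INR a) / INR n)) + 4 * u ^ 2 * INR n).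
Proof.
move=> an hu; have u2 := pow2_ge_0 u.
have [k nk] := ubnP n; elim: k n a nk an => // k IH [|[|n]] a nk an.
- move: an; rewrite leqn0 => /eqP -> /=; apply: exp_mono; lra.
- have -> : Ex 1 a (fun X => exp (- (u * INR (mixed X)))) = 1.
    by rewrite /= Rmult_0_r Ropp_0 exp_0; ring.
  rewrite -{1}exp_0; apply: exp_mono.
  by case: a an => [|[|//]] _ /=; lra.
rewrite Ex_two_step; set G := fun X => _.
have em : INR n.+2 = INR n + 2 by rewrite !S_INR; ring.
(* Two letters of different values form a mixed pair with certainty, while the potential is only
   1/2. *)
have [n0|n0] := posnP n.
  have G0 : G [::] = 1 by rewrite /G /= Rmult_0_r Ropp_0 exp_0.
  subst n; rewrite em /= G0.
  case: a an => [|[|[|//]]] _ /=.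
  - apply: (Rle_trans _ 1); first by right; field.
    by rewrite -{1}exp_0; apply: exp_mono; nra.
  - apply: (Rle_trans _ (exp (- u))); first by right; field.
    by apply: exp_mono; nra.
  - apply: (Rle_trans _ 1); first by right; field.
    by rewrite -{1}exp_0; apply: exp_mono; nra.
have M1 : 1 <= INR n by exact: (INR_leq n0).
have nk' : (n < k)%N by lia.
have IH' b : (b <= n)%N -> Ex n b G <=
    exp (- (u * (INR b * (INR n - INR b) / INR n)) + 4 * u ^ 2 * INR n).
  by move=> bn; apply: IH.
have x0 := pos_INR a; have xm := INR_leq an; rewrite em in xm *.
have cases : [\/ a = n.+2, a = n.+1 | (a <= n)%N].
  by case: (ltngtP a n.+1) => h; [apply: Or33|apply: Or31; lia|apply: Or32].
apply: mixed_step => //.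
- case: cases => [->|->|h]; [left|left|right].
  + by rewrite em; field; lra.
  + by rewrite S_INR; field; lra.
  + by split; [exact: INR_leq|exact: IH'].
- case: a an x0 xm cases => [|a] an x0 xm cases; first by left; rewrite /=; field; lra.
  have [e|h] : a.+1 = n.+2 \/ (a <= n)%N by lia.
    by left; rewrite e em; field; lra.
  right; have -> : INR a.+1 - 1 = INR a by rewrite S_INR; ring.
  exact: IH'.
- case: a an x0 xm cases => [|[|a]] an x0 xm cases.
  + by left; rewrite /=; field; lra.
  + by left; rewrite /=; field; lra.
  right; split; first by rewrite !S_INR; have := pos_INR a; lra.
  have -> : INR a.+2 - 2 = INR a by rewrite !S_INR; ring.
  exact: IH'.
Qed.

(** * Cancellations over all levels *)

(* Up to lower-order terms, a lower bound for the expected number of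
   cancellations in a string of length m whose majority leads by |d|. *)
Definition potential (m d : R) : R := m / 3 - Rabs d / 2 + d ^ 2 / (6 * m).

Definition lead (n a : nat) : R := 2 * INR a - INR n.

Lemma lead_bound n a : (a <= n)%N -> Rabs (lead n a) <= INR n.
Proof.
move=> /INR_leq h; have := pos_INR a; have := pos_INR n.
by rewrite /lead /Rabs; case: Rcase_abs; lra.
Qed.

(** The quadratic term is bounded below by its tangent: (|d| - rho m)^2 >= 0. For [m = 0] both the
    lead and the quotient are 0. *)
Lemma potential_tangent m d rho : Rabs d <= m ->
  m * (1 / 3 - rho ^ 2 / 6) - Rabs d * (1 / 2 - rho / 3) <= potential m d.
Proof.
move=> dm; rewrite /potential -(pow2_abs d); have := Rabs_pos d.
move: (Rabs d) dm => x xm x0.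
have [m0|m0] : 0 < m \/ m = 0 by lra.
  suff : 2 * rho * x - rho ^ 2 * m <= x ^ 2 / m.
    have -> : x ^ 2 / (6 * m) = x ^ 2 / m / 6 by field; lra.
    by lra.
  apply: (Rmult_le_reg_r m) => //.
  have -> : x ^ 2 / m * m = x ^ 2 by field; lra.
  by have := pow2_ge_0 (x - rho * m); nra.
have -> : x = 0 by lra.
by rewrite m0 /Rdiv Rmult_0_r Rinv_0; lra.
Qed.

Lemma potential_le m d : Rabs d <= m -> potential m d <= m.
Proof.
move=> dm; rewrite /potential -(pow2_abs d); have := Rabs_pos d.
move: (Rabs d) dm => x xm x0.
have [m0|m0] : 0 < m \/ m = 0 by lra.
  suff : x ^ 2 / (6 * m) <= m / 6 by lra.
  apply: (Rmult_le_reg_r (6 * m)); first lra.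
  have -> : x ^ 2 / (6 * m) * (6 * m) = x ^ 2 by field; lra.
  by nra.
have -> : x = 0 by lra.
by rewrite m0 /Rdiv Rmult_0_r Rinv_0; lra.
Qed.

(** Compression leaves n/2 minus the mixed count of letters and half the lead, up to rounding.
    Inserting this in the tangent bound gives an expression linear in the mixed count; the term 1/2
    absorbs the rounding. *)
Lemma potential_step X (n := INR (size X)) (d := lead (size X) (ones X))
    (Y := compress X) rho : 0 <= rho <= 1 ->
  INR (mixed X) * (2 / 3 + rho ^ 2 / 6) + n / 2 * (1 / 3 - rho ^ 2 / 6)
    - Rabs d / 2 * (1 / 2 - rho / 3) - 1 / 2
  <= INR (mixed X) + potential (INR (size Y)) (lead (size Y) (ones Y)).
Proof.
move=> hr.
have [s1 s2] := size_compress X.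
have lo := leftover_size X.
have eo := ones_compress X; rewrite -/Y in s1 s2 lo eo.
have [ol [es lol ol1]] : exists ol, [/\ size X = (2 * size Y + 2 * mixed X + ol)%N,
    (leftover X <= ol)%N & (ol <= 1)%N].
  by exists (size X - (2 * size Y + 2 * mixed X))%N; split; lia.
have en : n = 2 * INR (size Y) + 2 * INR (mixed X) + INR ol.
  by rewrite /n es (INRD (_ + _)) INRD !INRM /=; ring.
have ed : d = 2 * lead (size Y) (ones Y) + (2 * INR (leftover X) - INR ol).
  by rewrite /d /lead -/n en eo (INRD (_ + _)) INRD INRM /=; ring.
have := INR_leq lol; have := INR_leq ol1; have := pos_INR (leftover X).
rewrite [INR 1]/= => l0 o1 lo'.
have hd : Rabs (lead (size Y) (ones Y)) <= Rabs d / 2 + / 2.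
  by rewrite ed /Rabs; do 2 case: Rcase_abs; lra.
have := @potential_tangent _ _ rho (lead_bound (ones_le Y)).
have r2 : 0 <= rho ^ 2 <= 1 by nra.
have q1 : Rabs (lead (size Y) (ones Y)) * (1 / 2 - rho / 3) <=
  (Rabs d / 2 + / 2) * (1 / 2 - rho / 3) by apply: Rmult_le_compat_r; lra.
have q2 : (n / 2 - INR (mixed X) - / 2) * (1 / 3 - rho ^ 2 / 6) <=
  INR (size Y) * (1 / 3 - rho ^ 2 / 6) by apply: Rmult_le_compat_r; lra.
by lra.
Qed.

(** At the typical mixed count a(n-a)/n the linear bound with slope [x] recovers the potential. The
    surplus is n x (6 - 5x - x^3)/24, nonnegative on [0,1]. *)
Lemma potential_balance n a (x := Rabs (lead n a) / INR n) : (a <= n)%N ->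
  potential (INR n) (lead n a) <=
  (2 / 3 + x ^ 2 / 6) * (INR a * (INR n - INR a) / INR n)
  + INR n / 2 * (1 / 3 - x ^ 2 / 6)
  - Rabs (lead n a) / 2 * (1 / 2 - x / 3).
Proof.
move=> an; have dn := lead_bound an; have d0 := Rabs_pos (lead n a).
have e4 : INR a * (INR n - INR a) = (INR n ^ 2 - Rabs (lead n a) ^ 2) / 4.
  by rewrite pow2_abs /lead; field.
rewrite /potential -(pow2_abs (lead n a)) e4 /x.
move: (Rabs _) dn d0 => d dn d0; set m := INR n in dn *.
have [m0|m0] : 0 < m \/ m = 0 by lra.
  pose y := d / m; have ey : d = y * m by rewrite /y; field; lra.
  have hy : 0 <= y <= 1.
    split; first by apply: Rle_mult_inv_pos.
    by apply: (Rmult_le_reg_r m); lra.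
  have -> : d / m = y by [].
  rewrite ey; apply: Rminus_le.
  have -> : m / 3 - y * m / 2 + (y * m) ^ 2 / (6 * m) -
    ((2 / 3 + y ^ 2 / 6) * ((m ^ 2 - (y * m) ^ 2) / 4 / m) +
    m / 2 * (1 / 3 - y ^ 2 / 6) - y * m / 2 * (1 / 2 - y / 3)) =
    - (m * y * (6 - 5 * y - y ^ 3)) / 24 by field; lra.
  have y2 : 0 <= y ^ 2 <= 1 by nra.
  have : 0 <= 6 - 5 * y - y ^ 3 by nra.
  have : 0 <= m * y by nra.
  by nra.
have -> : d = 0 by lra.
by rewrite m0 /Rdiv !Rmult_0_r Rinv_0; lra.
Qed.

(* Induction on the number of levels.  Linearising the potential at the typical
   number of mixed pairs keeps the exponent linear in that number, so that only
   one-sided exponential moments are needed and no factor is lost per level. *)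
Lemma cancels_mgf l k n a : 0 <= l <= / 4 -> (a <= n)%N ->
  Ex n a (fun X => exp (- (l * INR (cancels k X)))) <=
  exp (- (l * potential (INR n) (lead n a)) + 6 * l ^ 2 * INR n
       + l * (INR k / 2 + INR n / 2 ^ k)).
Proof.
move=> hl; elim: k n a => [|k IH] n a an.
  rewrite /= Rmult_0_r Ropp_0 exp_0 Ex_const -{1}exp_0; apply: exp_mono.
  (* With no level left, the term n/2^0 pays for the whole potential. *)
  have h1 := potential_le (lead_bound an).
  by have := pos_INR n; have := pow2_ge_0 l; nra.
pose Bd m b := exp (- (l * potential (INR m) (lead m b)) + 6 * l ^ 2 * INR m
       + l * (INR k / 2 + INR m / 2 ^ k)).
pose f Y := exp (- (l * INR (cancels k Y))).
pose w d := exp (- (l * INR d)).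
have H m b : (b <= m)%N ->
    Ex m b (fun Y => -1 * Bd (size Y) (ones Y) + f Y) <= 0.
  move=> bm; rewrite Ex_linear (@Ex_eq m b _ (fun=> Bd m b)) //; last first.
    by move=> X -> ->.
  by rewrite Ex_const; have := IH m b bm; rewrite -/f -/(Bd m b); lra.
have w0 d : 0 <= w d by left; exact: exp_pos.
have := Ex_compress an w0 H.
rewrite (@Ex_ext n a _ (fun X =>
  -1 * (w (mixed X) * Bd (size (compress X)) (ones (compress X)))
  + exp (- (l * INR (cancels k.+1 X))))); last first.
  move=> X; rewrite Rmult_plus_distr_l /w /f -[X in _ + X]exp_plus; congr (_ + exp _).
    by ring.
  by rewrite [cancels k.+1 X]/= INRD; ring.
rewrite Ex_linear => main.
apply: (Rle_trans _ (Ex n a (fun X =>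
  w (mixed X) * Bd (size (compress X)) (ones (compress X))))); first by lra.
pose x := Rabs (lead n a) / INR n.
have hx : 0 <= x <= 1.
  have h1 := lead_bound an; have h2 := Rabs_pos (lead n a); rewrite /x.
  have [n0|->] : 0 < INR n \/ INR n = 0 by have := pos_INR n; lra.
    split; first by apply: Rle_mult_inv_pos.
    by apply: (Rmult_le_reg_r (INR n)) => //; rewrite /Rdiv Rmult_assoc Rinv_l; lra.
  by rewrite /Rdiv Rinv_0; lra.
have x2 : 0 <= x ^ 2 <= 1 by nra.
(* [u] is the coefficient of the mixed count. From u <= 5l/6 the mixed pairs cost 4u^2 n <= 3l^2 n,
   and the compressed string, at most half as long, costs the other 3l^2 n. *)
pose u := l * (2 / 3 + x ^ 2 / 6).
have hu : 0 <= u <= / 4 by rewrite /u; nra.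
pose K := - l * (INR n / 2 * (1 / 3 - x ^ 2 / 6)
   - Rabs (lead n a) / 2 * (1 / 2 - x / 3) - 1 / 2)
   + 3 * l ^ 2 * INR n + l * (INR k / 2 + INR n / 2 ^ k.+1).
have k2 : 0 < / 2 ^ k by apply: Rinv_0_lt_compat; apply: pow_lt; lra.
have ek : INR n / 2 ^ k.+1 = INR n / 2 * / 2 ^ k.
  by rewrite /=; field; apply: pow_nonzero; lra.
apply: (Rle_trans _ (exp K * exp (- (u * (INR a * (INR n - INR a) / INR n))
    + 4 * u ^ 2 * INR n))); last first.
  rewrite -exp_plus; apply: exp_mono.
  have hb := potential_balance an; rewrite -/x in hb.
  have h4 : 4 * u ^ 2 * INR n <= 3 * l ^ 2 * INR n.
    apply: Rmult_le_compat_r; first exact: pos_INR.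
    have : u <= l * (5 / 6) by rewrite /u; nra.
    by nra.
  have := Rmult_le_compat_l l _ _ (proj1 hl) hb.
  by rewrite S_INR /K /u in h4 *; lra.
apply: (Rle_trans _ (Ex n a (fun X => exp K * exp (- (u * INR (mixed X)))))).
  apply: Ex_le => // X sX oX.
  rewrite /w /Bd -!exp_plus; apply: exp_mono.
  have hs := potential_step X hx; rewrite sX oX in hs.
  have [_ s2] := size_compress X; rewrite sX in s2.
  have sY : INR (size (compress X)) <= INR n / 2.
    have := @INR_leq (2 * size (compress X)) n _; rewrite INRM [INR 2]/= => h.
    by suff : (1 + 1) * INR (size (compress X)) <= INR n; [lra|apply: h; lia].
  have h1 : 6 * l ^ 2 * INR (size (compress X)) <= 3 * l ^ 2 * INR n.
    by have := pow2_ge_0 l; nra.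
  have h2 : INR (size (compress X)) / 2 ^ k <= INR n / 2 ^ k.+1.
    by rewrite ek; apply: Rmult_le_compat_r; lra.
  have h3 := Rmult_le_compat_l l _ _ (proj1 hl) h2.
  have h4 := Rmult_le_compat_l l _ _ (proj1 hl) hs.
  by rewrite /K /u; lra.
rewrite Ex_scale; apply: Rmult_le_compat_l; first by left; exact: exp_pos.
exact: mixed_mgf.
Qed.

(** * The tail bound *)

Lemma nat_above x : 0 <= x -> exists n, x < INR n <= x + 1.
Proof.
move=> x0; have [h1 h2] := archimed x.
exists (Z.to_nat (up x)); rewrite INR_IZR_INZ Z2Nat.id; first by lra.
by apply: le_IZR; lra.
Qed.

Lemma nat_floor x : 0 <= x -> exists n, INR n <= x < INR n + 1.
Proof.
move=> x0; have [[|n] [h1 h2]] := nat_above x0.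
  by move: h1; rewrite /=; lra.
by exists n; move: h1 h2; rewrite S_INR; lra.
Qed.

Lemma strays_drop theta D X m : ~~ strays theta D X -> (m <= size X)%N ->
  Rabs (drift theta (size X - m) (ones (drop m X))) < D.
Proof.
elim: X m => [|b X IH] m.
  by rewrite [strays _ _ _]/= orbF leqn0 => /RlebP h /eqP ->; apply: Rnot_le_lt.
rewrite strays_cons negb_or => /andP[/RlebP h1 h2].
case: m => [|m] mX; last exact: IH.
by rewrite drop0 subn0; apply: Rnot_le_lt.
Qed.

Lemma walk_ones X m : (m <= size X)%N ->
  IZR (walk true X m) = 2 * INR (ones (take m X)) - INR m /\
  IZR (walk false X m) = - (2 * INR (ones (take m X)) - INR m).
Proof.
move=> mX.
have e : count_mem true (take m X) = ones (take m X).
  by apply: eq_count => -[].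
have sz := size_takel mX.
have e2 : (count_mem false (take m X) + ones (take m X) = m)%N.
  rewrite -{3}sz /ones -(count_predC (pred1 false)); congr (_ + _)%N.
  by apply: eq_count => -[].
have e3 : INR m = INR (count_mem false (take m X)) + INR (ones (take m X)).
  by rewrite -INRD e2.
by rewrite /walk !minus_IZR !mult_IZR -!INR_IZR_INZ sz e e3; split; ring.
Qed.

Lemma gp_count_le X fuel S : (gp_count X fuel S <= fuel)%N.
Proof. by elim: fuel S => //= fuel IH S; case: ifP => // _; apply: IH. Qed.

Lemma C_GP_concentrated N A B X t n1 k :
  (A + B)%N = N -> size X = N -> ones X = A -> 1 <= t -> 212 * t <= INR N ->
  let theta := (INR A - INR B) / INR N in
  ~~ strays theta (12 * t) X ->
  INR n1 <= (INR N - 204 * t - 8) / (1 + Rabs theta) < INR n1 + 1 ->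
  potential (INR n1) (lead n1 (ones (take n1 X)))
    - INR (cancels k (take n1 X)) <= 12 * t ->
  INR (C_GP X) < INR N / 2 + INR (minn A B) / 3 + 300 * t.
Proof.
move=> AB sX oX t1 Nt theta nostray [n1l n1u] dev.
have N0 : 0 < INR N by lra.
have eN : INR N = INR A + INR B by rewrite -AB INRD.
(* [v] is the majority letter and [s] its sign, which makes the slope of the walk |theta|. *)
have [v vE] : exists v, v = (B <= A)%N by exists (B <= A)%N.
pose s := if v then 1 else -1.
have [eth eabs emin] : [/\ s * theta = Rabs theta,
    Rabs theta * INR N = s * (INR A - INR B)
  & INR (minn A B) = INR N * (1 - Rabs theta) / 2].
  have i0 : 0 < / INR N by exact: Rinv_0_lt_compat.
  have eT : theta * INR N = INR A - INR B by rewrite /theta; field; lra.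
  have h : s * theta = Rabs theta.
    rewrite /s vE; case: leqP => [|/ltnW] /INR_leq hAB.
      by rewrite Rabs_pos_eq; [lra|nra].
    by rewrite Rabs_left1; [lra|nra].
  split=> //; first by rewrite -h -eT; ring.
  rewrite -h; have -> : INR N * (1 - s * theta) / 2 =
    (INR N - s * (theta * INR N)) / 2 by field.
  rewrite eT eN /s vE.
  by have [h1|h1] := leqP B A; field.
have th0 := Rabs_pos theta.
have th1 : Rabs theta <= 1.
  apply: (Rmult_le_reg_r (INR N)) => //; rewrite eabs Rmult_1_l eN /s.
  by have := pos_INR A; have := pos_INR B; case: (v); lra.
set th := Rabs theta in eth eabs emin th0 th1 n1l n1u.
(* The whole string has drift 0, so deviations of suffixes are deviations of prefixes up to sign. *)
have W m : (m <= N)%N -> Rabs (IZR (walk v X m) - th * INR m) < 12 * t.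
  move=> mN; have mX : (m <= size X)%N by rewrite sX.
  have := strays_drop nostray mX; rewrite /drift.
  have -> : INR (size X - m) = INR N - INR m.
    by rewrite -[in RHS](subnK mN) sX INRD; ring.
  have -> : INR (ones (drop m X)) = INR A - INR (ones (take m X)).
    by rewrite -oX -{2}(cat_take_drop m X) /ones count_cat INRD; ring.
  have [w1 w0] := walk_ones mX.
  have eT : theta * INR N = INR A - INR B by rewrite /theta; field; lra.
  have -> : theta * (INR N - INR m) - (2 * (INR A - INR (ones (take m X)))
      - (INR N - INR m)) = 2 * INR (ones (take m X)) - INR m - theta * INR m.
    by rewrite Rmult_minus_distr_l eT eN; ring.
  rewrite -eth /s; case: (v); rewrite ?w1 ?w0.
    by rewrite Rmult_1_l.
  by rewrite -Rabs_Ropp => h; apply: Rle_lt_trans h; right; congr Rabs; ring.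
have Wb m (mN : (m <= N)%N) : th * INR m - 12 * t < IZR (walk v X m) < th * INR m + 12 * t.
  by have := W m mN; rewrite /Rabs; case: Rcase_abs; lra.
(* The walk stays within 12t of a nondecreasing line, so it drops by less than 24t. Then 8e <= 192t
   + 8, and with the 12t of [W] this is the 204t + 8 in the choice of [n1]. *)
have [e [e1 e2]] : exists e, 24 * t < INR e <= 24 * t + 1 by apply: nat_above; lra.
have z0 : 0 <= (INR N + 12 * t) / (1 + th) + 1.
  have : 0 <= (INR N + 12 * t) / (1 + th) by apply: Rle_mult_inv_pos; lra.
  by lra.
have [n2 [n2l n2u]] := nat_above z0.
have n1N : (n1 <= N)%N.
  apply/leP/INR_le; apply: (Rle_trans _ _ _ n1l).
  apply: (Rmult_le_reg_r (1 + th)); first lra.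
  by rewrite /Rdiv Rmult_assoc Rinv_l; [nra|lra].
have n1l' : INR n1 * (1 + th) <= INR N - 204 * t - 8.
  have := Rmult_le_compat_r (1 + th) _ _ ltac:(lra) n1l.
  by rewrite /Rdiv Rmult_assoc Rinv_l; lra.
have sub m (mN : (m <= N)%N) : IZR (Z.of_nat (size X - m)) = INR N - INR m.
  by rewrite -INR_IZR_INZ sX -[in RHS](subnK mN) INRD; ring.
have F1 a b : (a <= b)%N -> (b <= size X)%N ->
    (walk v X a <= walk v X b + Z.of_nat e)%Z.
  rewrite sX => ab bN; apply: le_IZR; rewrite plus_IZR -INR_IZR_INZ.
  have := Wb a (leq_trans ab bN); have := Wb b bN; have := INR_leq ab.
  by nra.
have F2 m : (m <= size X)%N -> (walk v X m <= Z.of_nat (size X - m))%Z ->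
    (m + 2 <= n2)%N.
  rewrite {1}sX => mN /IZR_le; rewrite sub // => h; have := Wb m mN => hW.
  have : INR m <= (INR N + 12 * t) / (1 + th).
    apply: (Rmult_le_reg_r (1 + th)); first lra.
    by rewrite /Rdiv Rmult_assoc Rinv_l; lra.
  move=> h2; have : INR m + 1 < INR n2 by lra.
  rewrite -S_INR => /INR_lt; lia.
have F3 m : (m <= n1)%N ->
    (walk v X m + 8 * Z.of_nat e <= Z.of_nat (size X - m))%Z.
  move=> mn; have mN := leq_trans mn n1N.
  apply: le_IZR; rewrite plus_IZR mult_IZR sub // -INR_IZR_INZ.
  have := Wb m mN; have := INR_leq mn; nra.
have X0 : (0 < size X)%N by rewrite sX; apply/ltP/INR_lt; rewrite /=; lra.
have n1X : (n1 <= size X)%N by rewrite sX.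
have main := C_GP_le k F1 F2 F3 n1X X0.
have {main} main : INR (C_GP X) + INR (cancels k (take n1 X)) <= INR n2 + 1.
  rewrite -S_INR -INRD; apply: INR_leq; lia.
have sT : size (take n1 X) = n1 by rewrite size_takel.
have ld : Rabs (lead n1 (ones (take n1 X))) <= th * INR n1 + 12 * t.
  have [w1 w0] := walk_ones n1X; have := Wb n1 n1N.
  have := pos_INR n1; rewrite /lead.
  by case: (v); rewrite ?w1 ?w0 /Rabs; case: Rcase_abs; nra.
have lb : Rabs (lead n1 (ones (take n1 X))) <= INR n1.
  by apply: lead_bound; rewrite -{2}sT ones_le.
have tang := potential_tangent th lb.
have q1 : Rabs (lead n1 (ones (take n1 X))) * (1 / 2 - th / 3) <=
  (th * INR n1 + 12 * t) * (1 / 2 - th / 3) by apply: Rmult_le_compat_r; lra.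
(* The value of the tangent bound per letter at slope [th]. *)
pose f := (1 - th) * (2 - th) / 6.
have hf : 0 <= f <= 1 / 3 by rewrite /f; nra.
have q2 : INR n1 * f - 6 * t <=
    potential (INR n1) (lead n1 (ones (take n1 X))).
  apply: Rle_trans tang; rewrite /f.
  have : 0 <= th * t by nra.
  by move: q1; lra.
have q3 : ((INR N - 204 * t - 8) / (1 + th) - 1) * f <= INR n1 * f.
  by apply: Rmult_le_compat_r; lra.
pose j := / (1 + th).
have j1 : 0 < j <= 1.
  split; first by apply: Rinv_0_lt_compat; lra.
  by rewrite -Rinv_1; apply: Rinv_le_contravar; lra.
(* The main terms balance because 1 - f = (1 + th)(4 - th)/6. *)
have q4 : INR N / (1 + th) - INR N / (1 + th) * f = INR N / 2 + INR (minn A B) / 3.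
  by rewrite emin /f; field; lra.
have q5 : (204 * t + 8) * (j * f) <= (204 * t + 8) * (1 / 3).
  by apply: Rmult_le_compat_l; [lra|nra].
have q6 : 12 * t * j <= 12 * t by nra.
move: n2l n2u q3 q4; rewrite /Rdiv -/j => *.
by lra.
Qed.

(** The left side is at most 3 exp(-4r), and exp(3r) >= 3; finally ln 2 <= 1. *)
Lemma exp_tail r : 1 <= r -> 2 * exp (- (10 * r)) + exp (- (9 / 2 * r)) <= Rpower 2 (- r).
Proof.
move=> r1.
have h : exp (- r) <= Rpower 2 (- r).
  rewrite /Rpower; apply: exp_mono.
  have : ln 2 <= 1.
    rewrite -(ln_exp 1); apply: Rlt_le; apply: ln_increasing; first lra.
    by have := exp_ineq1 1 R1_neq_R0; lra.
  have : 0 < ln 2 by rewrite -ln_1; apply: ln_increasing; lra.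
  by nra.
apply: Rle_trans h.
have e3 : 3 <= exp (3 * r) by have := exp_ineq1_le (3 * r); lra.
have e1 : exp (- (10 * r)) <= exp (- (4 * r)) by apply: exp_mono; lra.
have e2 : exp (- (9 / 2 * r)) <= exp (- (4 * r)) by apply: exp_mono; lra.
have -> : exp (- r) = exp (3 * r) * exp (- (4 * r)).
  by rewrite -exp_plus; congr exp; ring.
by have := exp_pos (- (4 * r)); nra.
Qed.

Theorem mainTheorem7 :
  exists d : R,
    forall (N A B : nat), (0 < N)%N -> (A + B)%N = N ->
    forall r : R, 1 <= r ->
      prob_uniform N A
        (fun X => Rleb (INR N / 2 + INR (minn A B) / 3 + d * sqrt (r * INR N))
                       (INR (C_GP X)))
      <= Rpower 2 (- r) * log2 (INR N).
Proof.
exists 300 => N A B N0 AB r r1.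
have AN : (A <= N)%N by rewrite -AB leq_addr.
have N1 : 1 <= INR N by exact: (INR_leq N0).
set t := sqrt (r * INR N).
have tt : t * t = r * INR N by apply: sqrt_sqrt; nra.
have t0 : 0 <= t by exact: sqrt_pos.
have t1 : 1 <= t by nra.
have min0 := pos_INR (minn A B).
have ln2 : 0 < ln 2 by rewrite -ln_1; apply: ln_increasing; lra.
have rp : 0 < Rpower 2 (- r) by exact: exp_pos.
rewrite prob_uniform_Ex //.
(* For such small [N] the threshold exceeds [N], which bounds the number of queries, so the event is
   empty. Otherwise [N] is at least 212 and its logarithm at least 1. *)
have [Nt|Nt] := Rlt_le_dec (INR N) (212 * t).
  apply: (Rle_trans _ (Ex N A (fun=> 0))).
    apply: Ex_le => // X sX _; case: RlebP => [h|_]; last by right.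
    have : INR (C_GP X) <= INR N by apply: INR_leq; rewrite -sX; exact: gp_count_le.
    by lra.
  rewrite Ex_const; apply: Rmult_le_pos; first lra.
  apply: Rle_mult_inv_pos => //.
  have [h|<-] : 1 < INR N \/ 1 = INR N by lra.
    by rewrite -ln_1; apply: Rlt_le; apply: ln_increasing; lra.
  by rewrite ln_1; right.
have log1 : 1 <= log2 (INR N).
  apply: (Rmult_le_reg_r (ln 2)) => //.
  rewrite /log2 /Rdiv Rmult_assoc Rinv_l; last by lra.
  by rewrite Rmult_1_l Rmult_1_r; apply: Rlt_le; apply: ln_increasing; lra.
apply: (Rle_trans _ (Rpower 2 (- r))); last by nra.
(* This scale makes both l^2 N and l t equal to r. *)
pose l := t / INR N.
have lN : l * INR N = t by rewrite /l; field; lra.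
have hl : 0 <= l <= / 4.
  split; first by apply: Rle_mult_inv_pos; lra.
  by apply: (Rmult_le_reg_r (INR N)); lra.
have l2N : l ^ 2 * INR N = r.
  have : l ^ 2 * INR N * INR N = r * INR N by rewrite -tt -lN; ring.
  by move/Rmult_eq_reg_r => H; apply: H; lra.
have lr : l * t = r by rewrite -{1}lN -l2N; ring.
pose theta := (INR A - INR B) / INR N.
have th0 := Rabs_pos theta.
have z0 : 0 <= (INR N - 204 * t - 8) / (1 + Rabs theta).
  by apply: Rle_mult_inv_pos; lra.
have [n1 hn1] := nat_floor z0.
have n1N : (n1 <= N)%N.
  apply/leP/INR_le; apply: (Rle_trans _ _ _ (proj1 hn1)).
  apply: (Rmult_le_reg_r (1 + Rabs theta)); first lra.
  by rewrite /Rdiv Rmult_assoc Rinv_l; [nra|lra].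
(* With about sqrt N levels, k <= t, and Bernoulli's inequality gives 2^k >= sqrt N, so the
   remainder n1/2^k is at most t. The exponent is then at most 6r + 3r/2. *)
have [k [k1 k2]] := nat_floor (sqrt_pos (INR N)).
pose g Y := exp (l * potential (INR n1) (lead n1 (ones Y)) - l * INR (cancels k Y)).
have Eg : Ex N A (fun X => g (take n1 X)) <= exp (15 / 2 * r).
  apply: Ex_take => // a an.
  rewrite (@Ex_eq _ _ _ (fun Y => exp (l * potential (INR n1) (lead n1 a)) *
    exp (- (l * INR (cancels k Y))))) //; last first.
    by move=> Y _ <-; rewrite /g -exp_plus.
  rewrite Ex_scale.
  have h := cancels_mgf k hl an.
  have p := exp_pos (l * potential (INR n1) (lead n1 a)).
  apply: (Rle_trans _ _ _ (Rmult_le_compat_l _ _ _ (Rlt_le _ _ p) h)).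
  rewrite -exp_plus; apply: exp_mono.
  have n1r := INR_leq n1N.
  have a1 : 6 * l ^ 2 * INR n1 <= 6 * r by rewrite -l2N; have := pow2_ge_0 l; nra.
  have sN := sqrt_sqrt (INR N) (pos_INR N).
  have st : sqrt (INR N) <= t by apply: sqrt_le_1_alt; nra.
  have p2 : sqrt (INR N) <= 2 ^ k.
    apply: (Rle_trans _ (INR k + 1)); first lra.
    have := poly k 1 Rlt_0_1; rewrite (_ : 1 + 1 = 2); last by ring.
    by lra.
  have p3 : 0 < 2 ^ k by apply: pow_lt; lra.
  have a2 : INR n1 / 2 ^ k <= t.
    apply: (Rmult_le_reg_r (2 ^ k)) => //.
    rewrite /Rdiv Rmult_assoc Rinv_l; last by lra.
    by have := sqrt_pos (INR N); nra.
  have a3 : l * (INR k / 2 + INR n1 / 2 ^ k) <= l * (3 / 2 * t).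
    by apply: Rmult_le_compat_l; lra.
  by lra.
have Es := @strays_bound theta (12 * t) l N A AN hl.
have {}Es : Ex N A (fun X => if strays theta (12 * t) X then 1 else 0)
    <= 2 * exp (- (10 * r)).
  apply: (Rle_trans _ _ _ Es).
  have -> : drift theta N A = 0.
    by rewrite /drift /theta -AB INRD; field; rewrite -INRD AB; lra.
  have -> : 2 * l ^ 2 * INR N - l * (12 * t) = - (10 * r).
    have -> : 2 * l ^ 2 * INR N - l * (12 * t) = 2 * (l ^ 2 * INR N) - 12 * (l * t) by ring.
    by rewrite l2N lr; ring.
  by rewrite Rmult_0_r Ropp_0 exp_0; lra.
apply: Rle_trans (exp_tail r1).
(* Markov's inequality: a bad string strays, or its potential exceeds its cancellations by more than
   12t and the first term is at least 1. *)
apply: (Rle_trans _ (Ex N A (fun X => exp (- (12 * r)) * g (take n1 X) +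
  (if strays theta (12 * t) X then 1 else 0)))); last first.
  rewrite Ex_linear.
  have := Rmult_le_compat_l _ _ _ (Rlt_le _ _ (exp_pos (- (12 * r)))) Eg.
  rewrite -exp_plus (_ : - (12 * r) + 15 / 2 * r = - (9 / 2 * r)); last by field.
  by lra.
apply: Ex_le => // X sX oX.
have g0 : 0 < exp (- (12 * r)) * g (take n1 X).
  by apply: Rmult_lt_0_compat; exact: exp_pos.
case: RlebP => [hC|_]; last by case: ifP => _; lra.
case: ifP => [_|/negbT ns]; first by lra.
rewrite Rplus_0_r /g -exp_plus -{1}exp_0; apply: exp_mono.
apply: Rnot_lt_le => lt0.
have dev : potential (INR n1) (lead n1 (ones (take n1 X)))
    - INR (cancels k (take n1 X)) <= 12 * t.
  apply: Rnot_lt_le => lt1.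
  have : l * (12 * t) <= l * (potential (INR n1) (lead n1 (ones (take n1 X)))
    - INR (cancels k (take n1 X))) by apply: Rmult_le_compat_l; lra.
  by lra.
have := C_GP_concentrated AB sX oX t1 Nt ns hn1 dev.
by lra.
Qed.
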